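(* Let $n\ge1$, $1\le k\le p$, let $t\ge0$ be any real number, and let $(X_1,Y_1),\ldots,(X_n,Y_n)$ be independent random vectors in $\mathbb{R}^p\times\mathbb{R}$. Let $\alpha>0$ and $K_{n,p}>0$. (a) Suppose (MExp): $\max_{1\le j\le p}\max\{\|X_i(j)\|_{\psi_\alpha},\|Y_i\|_{\psi_\alpha}\}\le K_{n,p}$ for all $1\le i\le n$. Then with probability at least $1-6e^{-t}$, the following two inequalities hold simultaneously: $$\mathcal{D}_n(k)\le14\sqrt{\frac{\Upsilon_{n,k}^\Gamma(t+k\log(3ep/k))}{n}}+C_\alpha K_{n,p}^2\frac{k^{1/2}(\log(2n))^{2/\alpha}(t+k\log(3ep/k))^{1/T_1(\alpha/2)}}{n},$$ $$\mathrm{RIP}_n(k)\le14\sqrt{\frac{\Upsilon_{n,k}^\Sigma(t+k\log(5ep/k))}{n}}+C_\alpha K_{n,p}^2\frac{k(\log(2n))^{2/\alpha}(t+k\log(5ep/k))^{1/T_1(\alpha/2)}}{n}.$$ (b) Suppose (JExp): $\max\{\|X_i^\top\theta\|_{\psi_\alpha},\|Y_i\|_{\psi_\alpha}\}\le K_{n,p}$ for all $\theta\in\mathbb{R}^p$ with $\|\theta\|_2\le1$ and all $1\le i\le n$. Then with probability at least $1-6e^{-t}$, the following two inequalities hold simultaneously: $$\mathcal{D}_n(k)\le14\sqrt{\frac{\Upsilon_{n,k}^\Gamma(t+k\log(3ep/k))}{n}}+C_\alpha K_{n,p}^2\frac{(\log(2n))^{2/\alpha}(t+k\log(3ep/k))^{1/T_1(\alpha/2)}}{n},$$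 $$\mathrm{RIP}_n(k)\le14\sqrt{\frac{\Upsilon_{n,k}^\Sigma(t+k\log(5ep/k))}{n}}+C_\alpha K_{n,p}^2\frac{(\log(2n))^{2/\alpha}(t+k\log(5ep/k))^{1/T_1(\alpha/2)}}{n}.$$ Here $T_1(\lambda)=\min\{\lambda,1\}$ and $C_\alpha$ is a constant depending only on $\alpha$.
   Context: For a random variable $W$ and $\alpha>0$, $\|W\|_{\psi_\alpha}=\inf\{C>0:\mathbb{E}[\exp(|W|^\alpha/C^\alpha)]\le2\}$. $\Theta_k=\{\theta\in\mathbb{R}^p:\|\theta\|_0\le k,\|\theta\|_2\le1\}$, where $\|\theta\|_0$ is the number of non-zero entries. $\Upsilon_{n,k}^{\Gamma}=\sup_{\theta\in\Theta_k}\frac1n\sum_{i=1}^n\mathrm{Var}(\theta^\top X_iY_i)$, $\Upsilon_{n,k}^{\Sigma}=\sup_{\theta\in\Theta_k}\frac1n\sum_{i=1}^n\mathrm{Var}((\theta^\top X_i)^2)$. $X_i(j)$ is the $j$-th coordinate of $X_i$. $\mathcal{M}(k)=\{M\subseteq\{1,\ldots,p\}:1\le|M|\le k\}$; $v(M)$ and $A(M)$ denote the subvector with indices in $M$ and the submatrix with indices in $M\times M$. $\hat\Sigma_n=\frac1n\sum_iX_iX_i^\top$, $\hat\Gamma_n=\frac1n\sum_iX_iY_i$, $\Sigma_n=\mathbb{E}\hat\Sigma_n$, $\Gamma_n=\mathbb{E}\hat\Gamma_n$; $\mathrm{RIP}_n(k)=\sup_{M\in\mathcal{M}(k)}\|\hat\Sigma_n(M)-\Sigma_n(M)\|_{op}$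 and $\mathcal{D}_n(k)=\sup_{M\in\mathcal{M}(k)}\|\hat\Gamma_n(M)-\Gamma_n(M)\|_2$. *)

(* Defs.v *)
From HB Require Import structures.
From mathcomp Require Import all_boot all_order all_algebra.
From mathcomp Require Import all_classical all_reals all_analysis.

Set Implicit Arguments.
Unset Strict Implicit.
Unset Printing Implicit Defensive.
Import Order.TTheory GRing.Theory Num.Theory.

Local Open Scope classical_set_scope.
Local Open Scope ring_scope.

Section euclidean.
Context {R : realType}.

(* The library norm on matrices is the entrywise maximum, so the Euclidean
   norm and the operator norm it induces are defined here. *)
Definition l2norm (m : nat) (v : 'cV[R]_m) : R :=
  Num.sqrt (\sum_(j < m) v j 0 ^+ 2).

Definition opnorm (m : nat) (A : 'M[R]_m) : R :=
  sup [set l2norm (A *m u) | u in [set u : 'cV[R]_m | l2norm u <= 1]].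

Definition l0norm (m : nat) (v : 'cV[R]_m) : nat :=
  #|[pred j | v j 0 != 0]|.

Definition dotv (m : nat) (u v : 'cV[R]_m) : R := (u^T *m v) 0 0.

Definition Theta (p k : nat) : set 'cV[R]_p :=
  [set theta | (l0norm theta <= k)%N /\ l2norm theta <= 1].

Definition models (p k : nat) : set {set 'I_p} :=
  [set M : {set 'I_p} | (1 <= #|M| <= k)%N].

(* [enum_val] enumerates the elements of [M] in increasing order. *)
Definition subvec (p : nat) (M : {set 'I_p}) (v : 'cV[R]_p) : 'cV[R]_#|M| :=
  rowsub (@enum_val _ (mem M)) v.

Definition submat (p : nat) (M : {set 'I_p}) (A : 'M[R]_p) : 'M[R]_#|M| :=
  mxsub (@enum_val _ (mem M)) (@enum_val _ (mem M)) A.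

Definition T1 (lambda : R) : R := Num.min lambda 1.

End euclidean.

Arguments Theta {R} p k _.
Arguments models p k _ : clear implicits.

Section probability.
Local Open Scope ereal_scope.
Context {d : measure_display} {T : measurableType d} {R : realType}.
Variable P : probability T R.

(* Takes the value +oo when no constant is admissible. *)
Definition psi_norm (alpha : R) (W : T -> R) : \bar R :=
  ereal_inf [set C%:E | C in [set C : R | (0 < C)%R /\
    'E_P[fun w => expR (`|W w| `^ alpha / C `^ alpha)%R] <= 2%:E]].

(* Mutual independence of a finite family of random elements. *)
Definition independent_family (d' : measure_display) (T' : measurableType d')
    (I : finType) (Z : I -> T -> T') : Prop :=
  forall (J : {set I}) (B : I -> set T'), (forall i, measurable (B i)) ->
    P [set w | forall i, i \in J -> B i (Z i w)] =
    \prod_(i in J) P (Z i @^-1` B i).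

End probability.

Section sample.
Context {d : measure_display} {T : measurableType d} {R : realType}.
Variables (P : probability T R) (n p : nat).
(* Random vectors are tuple-valued, since tuples carry the product
   sigma-algebra whereas matrices carry none; [vec] reads them in R^p. *)
Variables (X : 'I_n -> {RV P >-> p.-tuple R}) (Y : 'I_n -> {RV P >-> R}).

Definition vec (i : 'I_n) (w : T) : 'cV[R]_p := \col_j tnth (X i w) j.

Definition Sigma_hat (w : T) : 'M[R]_p :=
  n%:R^-1 *: \sum_(i < n) vec i w *m (vec i w)^T.

Definition Gamma_hat (w : T) : 'cV[R]_p :=
  n%:R^-1 *: \sum_(i < n) Y i w *: vec i w.

(* The entries are integrable under [MExp] or [JExp] below. *)
Definition Sigma : 'M[R]_p :=
  \matrix_(a, b) fine ('E_P[fun w => Sigma_hat w a b])%E.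

Definition Gamma : 'cV[R]_p :=
  \col_a fine ('E_P[fun w => (Gamma_hat w a 0)%R])%E.

Definition RIP (k : nat) (w : T) : R :=
  sup [set opnorm (submat M (Sigma_hat w) - submat M Sigma)
      | M in models p k].

Definition DD (k : nat) (w : T) : R :=
  sup [set l2norm (subvec M (Gamma_hat w) - subvec M Gamma)
      | M in models p k].

(* Extended-real valued; under [MExp] or [JExp] below all the variances are
   bounded uniformly in [theta], so both suprema are finite and [fine] of them
   is their actual value. *)
Definition Upsilon_Gamma (k : nat) : \bar R :=
  ereal_sup [set ((n%:R^-1)%:E *
      \sum_(i < n) 'V_P[fun w => (dotv theta (vec i w) * Y i w)%R])%E
    | theta in Theta p k].

Definition Upsilon_Sigma (k : nat) : \bar R :=
  ereal_sup [set ((n%:R^-1)%:E *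
      \sum_(i < n) 'V_P[fun w => (dotv theta (vec i w) ^+ 2)%R])%E
    | theta in Theta p k].

Definition MExp (alpha K : R) : Prop :=
  forall i : 'I_n,
    (\big[maxe/-oo]_(j < p)
       maxe (psi_norm P alpha (fun w => (vec i w j 0)%R))
            (psi_norm P alpha (Y i)) <= K%:E)%E.

Definition JExp (alpha K : R) : Prop :=
  forall (i : 'I_n) (theta : 'cV[R]_p), l2norm theta <= 1 ->
    (maxe (psi_norm P alpha (fun w => dotv (vec i w) theta))
          (psi_norm P alpha (Y i)) <= K%:E)%E.

End sample.

(* Main.v *)
Require Import Defs.
From mathcomp Require Import all_boot all_order all_algebra.
From mathcomp Require Import all_classical all_reals all_analysis.
From mathcomp Require Import measurable_realfun.
From mathcomp Require Import ring lra.

(** The statistics DD and RIP are suprema, over sparse unit vectors theta, of the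
    averages of n independent centred variables: theta^T X_i Y_i for DD, and
    (theta^T X_i)^2 for RIP. The proof combines a concentration inequality for a
    single theta with a union bound over a finite net of sparse vectors.

    Concentration ([concentration]). The products have Orlicz exponent
    beta = alpha / 2 (Young's inequality). Each variable is clipped at a level of
    order log(2n)^(1/beta). The clipped variables are bounded, and Bernstein's
    argument gives the Gaussian term; the variance of the unclipped variable
    appears in it because clipping is a contraction. The overshoots are dealt
    with by the inequality (sum a_i)^g <= sum a_i^g for g = min (beta, 1): the
    variables a_i^g have exponential moments at most 1 + D / (2 n), where D bounds
    the Orlicz moments; their product over the sample is at most exp (D / 2), and
    as D <= 2 s Chernoff's bound controls the sum of the overshoots at the scale
    s^(1/g). This treats light and heavy tails alike. The
    exponential moments of sums factor by [integral_prod_independent], the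
    product rule for expectations derived from independence of events.

    Sparse vectors ([linear_net_bound], [quadratic_net_bound], [card_net]). The
    net consists of the k-sparse points of a cubic grid of mesh 1 / (q sqrt k).
    Rounding toward zero leads to a point of the net, and a generating function
    bounds its cardinal by exp (2 k + q k log (2 p / k)). For q = 2 a linear form, and for
    q = 4 a quadratic form of a symmetric matrix, is at most twice its maximum
    over the net. The single-vector inequality is used with s = 12 u, where u is
    t + k log (3 e p / k) or t + k log (5 e p / k). This pays for the cardinal of
    the net, and 2 * 2 * sqrt 12 <= 14 accounts for the constant of the Gaussian
    term.

    Hypotheses on the tails. Under the joint condition the sparse combinations
    have the scale K of the data. Under the marginal one, a k-sparse unit
    combination is at most sqrt k times the largest of k coordinates
    ([orlicz_moment_sparse]); the moment of that maximum is at most 2 k, and such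
    a factor is harmless since s is larger than k. *)

Set Implicit Arguments.
Unset Strict Implicit.
Unset Printing Implicit Defensive.
Import Order.TTheory GRing.Theory Num.Theory.

Local Open Scope classical_set_scope.
Local Open Scope ring_scope.

(** * Real inequalities *)

(** Squaring exp (- x / 2) >= 1 - x / 2 reduces the claim to
    x^2 (1 - 3 x + x^2) >= 0, hence the range up to 1 / 3. *)
Lemma expR_le_quadratic (R : realType) (x : R) :
  `|x| <= 3^-1 -> expR x <= 1 + x + x ^+ 2.
Proof.
rewrite ler_norml => /andP[xl xr].
have h : 1 - x / 2 <= (expR (x / 2))^-1.
  by rewrite -expRN; apply: le_trans (expR_ge1Dx _).
have e0 : 0 < expR (x / 2) by exact: expR_gt0.
have p0 : 0 < 1 - x / 2 by lra.
have {}h : expR (x / 2) * (1 - x / 2) <= 1.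
  by rewrite mulrC -ler_pdivlMr// mul1r.
have -> : expR x = expR (x / 2) ^+ 2.
  by rewrite -expRM_natr; congr expR; field.
have h2 : (expR (x / 2) * (1 - x / 2)) ^+ 2 <= 1.
  by rewrite expr_le1// mulr_ge0 ?ltW.
rewrite exprMn in h2.
have q0 : 0 < (1 - x / 2) ^+ 2 by rewrite exprn_gt0.
rewrite -(ler_pM2r q0) (le_trans h2)//.
have : 0 <= x ^+ 2 * (1 - 3 * x + x ^+ 2).
  by rewrite mulr_ge0 ?sqr_ge0//; have := sqr_ge0 x; lra.
nra.
Qed.

(** This is y <= exp y at y = x / (2 a), raised to the power a. *)
Lemma powR_le_expR (R : realType) (a x : R) : 0 < a -> 0 <= x ->
  x `^ a <= (2 * a) `^ a * expR (x / 2).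
Proof.
move=> a0 x0.
have a2 : 0 < 2 * a by lra.
have -> : x = 2 * a * (x / (2 * a)) by field; lra.
have x2 : 0 <= x / (2 * a) by rewrite divr_ge0// ltW.
rewrite powRM ?(ltW a2)//.
have -> : 2 * a * (x / (2 * a)) / 2 = x / (2 * a) * a by field; lra.
apply: ler_wpM2l; first exact: powR_ge0.
rewrite expRM ge0_ler_powR ?nnegrE ?expR_ge0 ?(ltW a0)//.
by rewrite ltW// (lt_le_trans _ (expR_ge1Dx _))//; lra.
Qed.

(** Each summand is a fraction y <= 1 of the total, and then y <= y^g. *)
Lemma powRD_le (R : realType) (g a b : R) : 0 < g -> g <= 1 ->
  0 <= a -> 0 <= b -> (a + b) `^ g <= a `^ g + b `^ g.
Proof.
move=> g0 g1 a0 b0.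
have [s0|] := ltP 0 (a + b); last first.
  move=> s0; have -> : a = 0 by lra.
  have -> : b = 0 by lra.
  by rewrite addr0 powR0 ?gt_eqF// addr0.
have h x : 0 <= x -> x <= a + b -> (a + b) `^ g * (x / (a + b)) <= x `^ g.
  move=> x0 xs; rewrite le_eqVlt in x0; case/orP: x0 => [/eqP<-|x0].
    by rewrite mul0r mulr0 powR_ge0.
  have -> : x `^ g = (a + b) `^ g * (x / (a + b)) `^ g.
    rewrite -powRM ?divr_ge0 ?(ltW x0) ?(ltW s0)//; congr (_ `^ _).
    by rewrite mulrC divfK// gt_eqF.
  apply: ler_wpM2l; first exact: powR_ge0.
  rewrite ger1_powR// divr_gt0//=.
  by rewrite ler_pdivrMr// mul1r.
have := lerD (h a a0 _) (h b b0 _).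
rewrite -mulrDr -mulrDl divff ?gt_eqF// mulr1; apply; lra.
Qed.

(** For exponents below one this takes the place of the triangle inequality:
    raised to the power g, the terms of a heavy-tailed sum acquire exponential
    moments. *)
Lemma sum_le_powR (R : realType) (I : Type) (r : seq I) (F : I -> R) (g : R) :
  0 < g -> g <= 1 -> (forall i, 0 <= F i) ->
  \sum_(i <- r) F i <= (\sum_(i <- r) F i `^ g) `^ (1 / g).
Proof.
move=> g0 g1 F0.
have S0 : 0 <= \sum_(i <- r) F i by exact: sumr_ge0.
have h : (\sum_(i <- r) F i) `^ g <= \sum_(i <- r) F i `^ g.
  elim: r {S0} => [|i r IH]; first by rewrite !big_nil powR0 ?gt_eqF.
  rewrite !big_cons (le_trans (powRD_le _ _ _ _))// ?sumr_ge0//.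
  by rewrite lerD2l.
have -> : \sum_(i <- r) F i = ((\sum_(i <- r) F i) `^ g) `^ (1 / g).
  by rewrite -powRrM mulrC divfK ?gt_eqF// powRr1.
rewrite ge0_ler_powR ?nnegrE ?powR_ge0 ?divr_ge0 ?(ltW g0)//.
by apply: sumr_ge0 => i _; exact: powR_ge0.
Qed.

(** * Measurability of elementary operations *)

Lemma measurable_fun_bigprod (R : realType) d (T : measurableType d)
    (I : Type) (r : seq I) (Q : pred I) (f : I -> T -> R) :
  (forall i, measurable_fun setT (f i)) ->
  measurable_fun setT (fun w => \prod_(i <- r | Q i) f i w).
Proof.
move=> mf; elim: r => [|i r IH].
  by under eq_fun do rewrite big_nil; exact: measurable_cst.
under eq_fun do rewrite big_cons; case: (Q i) => //.
by apply: measurable_funM.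
Qed.

Lemma measurable_fun_bigsum (R : realType) d (T : measurableType d)
    (I : Type) (r : seq I) (Q : pred I) (f : I -> T -> R) :
  (forall i, measurable_fun setT (f i)) ->
  measurable_fun setT (fun w => \sum_(i <- r | Q i) f i w).
Proof.
move=> mf; elim: r => [|i r IH].
  by under eq_fun do rewrite big_nil; exact: measurable_cst.
under eq_fun do rewrite big_cons; case: (Q i) => //.
by apply: measurable_funD.
Qed.

Lemma measurable_fun_powR (R : realType) d (T : measurableType d) (p : R)
    (f : T -> R) :
  measurable_fun setT f -> measurable_fun setT (fun w => f w `^ p).
Proof. by move=> mf; exact: (measurableT_comp (measurable_powR p) mf). Qed.

Lemma measurable_superlevel (R : realType) d (T : measurableType d)
    (f : T -> R) (c : R) :
  measurable_fun setT f -> measurable [set w | c <= f w].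
Proof.
move=> mf; rewrite -[X in measurable X]setTI.
by apply: measurable_fun_le => //; exact: measurable_cst.
Qed.

Lemma measurable_sublevel (R : realType) d (T : measurableType d)
    (f : T -> R) (c : R) :
  measurable_fun setT f -> measurable [set w | f w <= c].
Proof.
move=> mf; rewrite -[X in measurable X]setTI.
by apply: measurable_fun_le => //; exact: measurable_cst.
Qed.

Lemma measurable_strict_superlevel (R : realType) d (T : measurableType d)
    (f : T -> R) (c : R) :
  measurable_fun setT f -> measurable [set w | c < f w].
Proof.
move=> mf; have := measurableC (measurable_sublevel c mf); congr measurable.
by apply/seteqP; split => w /=; rewrite ltNge => /negP.
Qed.

(** * The product rule for independent families *)

Lemma independent_family_comp (R : realType) d d1 d2 (T : measurableType d)
    (T1 : measurableType d1) (T2 : measurableType d2) (P : probability T R)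
    (I : finType) (Z : I -> T -> T1) (g : I -> T1 -> T2) :
  (forall i, measurable_fun setT (g i)) ->
  independent_family P Z -> independent_family P (fun i => g i \o Z i).
Proof.
move=> mg indZ J B mB.
have := indZ J (fun i => g i @^-1` B i); apply => i.
by rewrite -[X in measurable X]setTI; exact: mg.
Qed.

Section product_rule.
Import HBNNSimple.
Local Open Scope ereal_scope.
Context {R : realType} {d d' : measure_display}
  {T : measurableType d} {T' : measurableType d'}.
Variable P : probability T R.

(** Both sides are linear in f and compatible with increasing limits, so it is
    enough to know the identity for indicators. *)
Lemma ge0_integralM_of_indic (G : T -> R) (Z : T -> T') (c : R) :
  (forall w, 0 <= G w)%R -> measurable_fun setT G -> measurable_fun setT Z ->
  (forall A, measurable A ->
    \int[P]_w (G w * \1_A (Z w))%:E = c%:E * \int[P]_w (\1_A (Z w))%:E) ->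
  forall f : T' -> R, (forall z, 0 <= f z)%R -> measurable_fun setT f ->
  \int[P]_w (G w * f (Z w))%:E = c%:E * \int[P]_w (f (Z w))%:E.
Proof.
move=> G0 mG mZ hA f f0 mf.
have mfE : measurable_fun setT (EFin \o f : T' -> \bar R) by exact/measurable_EFinP.
pose h := nnsfun_approx measurableT mfE.
have f0E x : setT x -> 0 <= (EFin \o f) x by rewrite /= lee_fin.
have cvh x : (fun n => (h n x)%:E) @ \oo --> (f x)%:E.
  exact: cvg_nnsfun_approx.
have ndh x : {homo (fun n => h n x) : a b / (a <= b)%N >-> (a <= b)%R}.
  by move=> a b ab; exact/lefP/nd_nnsfun_approx.
have mhZ n : measurable_fun setT (h n \o Z) by exact: measurableT_comp.
have m1 A : measurable A -> measurable_fun setT (fun w => \1_A (Z w) : R).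
  by move=> mA; apply: measurableT_comp => //; exact: measurable_indic.
have step n : \int[P]_w (G w * h n (Z w))%:E = c%:E * \int[P]_w (h n (Z w))%:E.
  have E w : (h n (Z w))%:E = \sum_(y \in range (h n))
      y%:E * (\1_(h n @^-1` [set y]) (Z w))%:E.
    by rewrite fimfunE -fsumEFin.
  have E2 w : (G w * h n (Z w))%:E = \sum_(y \in range (h n))
      y%:E * (G w * \1_(h n @^-1` [set y]) (Z w))%:E.
    rewrite EFinM E ge0_mule_fsumr.
      by apply: eq_fsbigr => y _; rewrite muleCA EFinM.
    move=> y; case: (y \in range (h n)) (@nnfun_muleindic_ge0 _ _ R (h n) y (Z w)) => //.
  rewrite (eq_integral _ _ (fun w _ => E2 w)) (eq_integral _ _ (fun w _ => E w)).
  have ny0 y w : 0 <= y%:E * (\1_(h n @^-1` [set y]) (Z w))%:E.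
    exact: nnfun_muleindic_ge0.
  have mp y : measurable (h n @^-1` [set y]) by exact: measurable_sfunP.
  rewrite !ge0_integral_fsum//; first last.
  - move=> y w _; rewrite EFinM muleCA mule_ge0 ?lee_fin//.
    exact: ny0.
  - move=> y; apply/measurable_EFinP; apply: measurable_funM => //.
    by apply: measurable_funM => //; exact: m1.
  - by move=> y; apply/measurable_EFinP; apply: measurable_funM => //; exact: m1.
  rewrite ge0_mule_fsumr; last by move=> y; apply: integral_ge0.
  apply: eq_fsbigr => y /set_mem[z _ <-].
  rewrite !ge0_integralZl//.
  - by rewrite hA// muleCA.
  - by apply/measurable_EFinP; exact: m1.
  - by rewrite lee_fin fun_ge0.
  - by apply/measurable_EFinP; apply: measurable_funM => //; exact: m1.
  - by move=> w _; rewrite lee_fin mulr_ge0.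
  - by rewrite lee_fin fun_ge0.
have L1 : \int[P]_w (G w * h n (Z w))%:E @[n --> \oo] -->
    \int[P]_w (G w * f (Z w))%:E.
  have -> : \int[P]_w (G w * f (Z w))%:E =
     \int[P]_w limn (fun n => (G w * h n (Z w))%:E).
    apply: eq_integral => w _; apply: esym; apply: cvg_lim => //.
    by under eq_fun do rewrite EFinM; rewrite EFinM; apply: cvgeZl (cvh _).
  apply: cvg_monotone_convergence => //.
  - move=> n; apply/measurable_EFinP; apply: measurable_funM => //.
    exact: mhZ.
  - by move=> n w _; rewrite lee_fin mulr_ge0 ?fun_ge0.
  - by move=> w _ a b ab; rewrite lee_fin ler_wpM2l// ndh.
have L2 : \int[P]_w (h n (Z w))%:E @[n --> \oo] --> \int[P]_w (f (Z w))%:E.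
  have -> : \int[P]_w (f (Z w))%:E = \int[P]_w limn (fun n => (h n (Z w))%:E).
    by apply: eq_integral => w _; apply/esym/cvg_lim => //; exact: cvh.
  apply: cvg_monotone_convergence => //.
  - by move=> n; apply/measurable_EFinP; exact: mhZ.
  - by move=> n w _; rewrite lee_fin fun_ge0.
  - by move=> w _ a b ab; rewrite lee_fin ndh.
apply: (cvg_unique (@ereal_hausdorff R) L1) => //=.
under eq_fun do rewrite step.
exact: cvgeZl.
Qed.

(** For indicators this is the definition of independence; the factors are then
    promoted to general functions one at a time, the product of all the others
    being held fixed. *)
Lemma integral_prod_independent (n : nat) (Z : 'I_n -> T -> T')
    (f : 'I_n -> T' -> R) :
  (forall i, measurable_fun setT (Z i)) -> independent_family P Z ->
  (forall i, measurable_fun setT (f i)) -> (forall i z, 0 <= f i z)%R ->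
  (forall i, \int[P]_w (f i (Z i w))%:E < +oo) ->
  \int[P]_w (\prod_i f i (Z i w))%:E = \prod_i \int[P]_w (f i (Z i w))%:E.
Proof.
move=> mZ indZ.
have mp A i : measurable A -> measurable (Z i @^-1` A).
  by move=> mA; rewrite -[X in measurable X]setTI; exact: mZ.
have Eind A i : measurable A ->
    \int[P]_w (\1_A (Z i w) : R)%:E = P (Z i @^-1` A).
  by move=> mA; have := integral_indic P measurableT (mp A i mA); rewrite setIT.
have indic (B : 'I_n -> set T') : (forall i, measurable (B i)) ->
    \int[P]_w (\prod_i \1_(B i) (Z i w) : R)%:E =
    \prod_i \int[P]_w (\1_(B i) (Z i w) : R)%:E.
  move=> mB.
  have -> : \int[P]_w (\prod_i \1_(B i) (Z i w) : R)%:E =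
      \int[P]_w (\1_[set w | forall i, i \in [set: 'I_n]%SET -> B i (Z i w)] w)%:E.
    apply: eq_integral => w _; congr (_%:E); rewrite indicE.
    have [H|H] := boolP (w \in _).
      rewrite big1// => i _; rewrite indicE mem_set//.
      by move: H; rewrite inE /=; apply; rewrite inE.
    have [i Hi] : exists i, ~ B i (Z i w).
      apply/existsNP => H'; move/negP: H; apply; rewrite inE /= => i _.
      exact: H'.
    by rewrite (bigD1 i)//= indicE memNset// mul0r.
  have mS : measurable [set w | forall i, i \in [set: 'I_n]%SET -> B i (Z i w)].
    rewrite [X in measurable X](_ : _ = \bigcap_(i in setT) (Z i @^-1` B i)).
      by apply: fin_bigcap_measurable => // i _; exact: mp.
    apply/seteqP; split => w /= H i; first by move=> _; apply: H; rewrite finset.in_setT.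
    by move=> _; exact: H.
  rewrite integral_indic// setIT; apply: etrans (indZ [set: 'I_n]%SET B mB) _.
  apply: eq_big => [i|i _]; first by rewrite inE.
  by rewrite Eind.
suff step m : forall f : 'I_n -> T' -> R,
    (forall i, measurable_fun setT (f i)) -> (forall i z, 0 <= f i z)%R ->
    (forall i, \int[P]_w (f i (Z i w))%:E < +oo) ->
    (forall i : 'I_n, (m <= i)%N ->
       exists2 B, measurable B & f i = \1_B) ->
    \int[P]_w (\prod_i f i (Z i w))%:E = \prod_i \int[P]_w (f i (Z i w))%:E.
  move=> mf f0 foo; apply: (step n) => // i; by rewrite leqNgt ltn_ord.
elim: m => [|m IH] {}f mf f0 foo hm.
  have /choice[B hB] : forall i, exists B, measurable B /\ f i = \1_B.
    by move=> i; have [B mB fB] := hm i isT; exists B.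
  have fE i : f i = \1_(B i) by case: (hB i).
  have := indic B (fun i => (hB i).1).
  rewrite (eq_bigr (fun i => \int[P]_w (f i (Z i w))%:E)); last first.
    by move=> i _; rewrite fE.
  by move=> <-; apply: eq_integral => w _; congr _%:E; apply: eq_bigr => i _;
    rewrite fE.
have [mn|] := ltnP m n; last first.
  by move=> nm; apply: IH => // i mi; have := leq_trans nm mi; rewrite leqNgt ltn_ord.
pose i0 := Ordinal mn.
pose G w := (\prod_(i | i != i0) f i (Z i w))%R.
pose c := (\prod_(i | i != i0) fine (\int[P]_w (f i (Z i w))%:E))%R.
have fineE i : (fine (\int[P]_w (f i (Z i w))%:E))%:E = \int[P]_w (f i (Z i w))%:E.
  by rewrite fineK// ge0_fin_numE ?foo//; apply: integral_ge0 => w _; rewrite lee_fin.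
have cE : \prod_(i | i != i0) \int[P]_w (f i (Z i w))%:E = c%:E.
  by rewrite /c -prodEFin; apply: eq_bigr => i _; rewrite fineE.
rewrite (bigD1 i0)//= cE muleC.
transitivity (\int[P]_w (G w * f i0 (Z i0 w))%:E).
  by apply: eq_integral => w _; rewrite (bigD1 i0)//= mulrC.
apply: ge0_integralM_of_indic => //.
- by move=> w; apply: prodr_ge0.
- apply: measurable_fun_bigprod => i _; exact: measurableT_comp.
move=> A mA.
pose f' i := if i == i0 then \1_A else f i.
have m1 : measurable_fun setT (\1_A : T' -> R) by exact: measurable_indic.
have mf' i : measurable_fun setT (f' i) by rewrite /f'; case: ifP.
have f'0 i z : (0 <= f' i z)%R by rewrite /f'; case: ifP.
have f'oo i : \int[P]_w (f' i (Z i w))%:E < +oo.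
  rewrite /f'; case: ifP => // _.
  by rewrite Eind// (le_lt_trans (probability_le1 _ (mp _ _ mA))) ?ltry.
have hm' (i : 'I_n) : (m <= i)%N -> exists2 B, measurable B & f' i = \1_B.
  rewrite /f' => mi; case: ifPn => [_|ii0]; first by exists A.
  apply: hm; rewrite ltn_neqAle mi andbT eq_sym.
  by apply: contra ii0 => /eqP e; apply/eqP/val_inj.
transitivity (\int[P]_w (\prod_i f' i (Z i w))%:E).
  apply: eq_integral => w _; rewrite [in RHS](bigD1 i0)//= /f' eqxx mulrC.
  by congr (_ * _)%:E; apply: eq_bigr => i /negbTE ->.
rewrite IH// (bigD1 i0)//= muleC; congr (_ * _).
  by rewrite -cE; apply: eq_bigr => i /negbTE; rewrite /f' => ->.
by apply: eq_integral => w _; rewrite /f' eqxx.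
Qed.

End product_rule.

(** * Clipping under an Orlicz moment condition *)

Definition clip (R : realType) (rho x : R) : R :=
  Num.max (- rho) (Num.min rho x).

Definition overshoot (R : realType) (rho x : R) : R :=
  if rho < `|x| then `|x| else 0.

Lemma clipE (R : realType) (rho x : R) : 0 <= rho ->
  clip rho x = if rho <= x then rho else if x <= - rho then - rho else x.
Proof.
move=> r0; rewrite /clip; case: (leP rho x) => h.
  by case: (leP (- rho) rho) => h2 //; lra.
by case: (leP (- rho) x) => h2; case: (leP x (- rho)) => h3 //; lra.
Qed.

Lemma clip_norm_le (R : realType) (rho x : R) : 0 <= rho -> `|clip rho x| <= rho.
Proof.
move=> r0; rewrite clipE// ler_norml.
by case: (leP rho x) => h; [|case: (leP x (- rho)) => h2]; lra.
Qed.

Lemma clip_contract (R : realType) (rho x y : R) : 0 <= rho ->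
  `|clip rho x - clip rho y| <= `|x - y|.
Proof.
move=> r0; have := ler_norm (x - y); have := ler_norm (y - x).
rewrite [`|y - x|]distrC !clipE// => hx hy; rewrite ler_norml.
by case: (leP rho x) => ?; [|case: (leP x (- rho)) => ?];
  (case: (leP rho y) => ?; [|case: (leP y (- rho)) => ?]); lra.
Qed.

Lemma clip_overshoot (R : realType) (rho x : R) : 0 <= rho ->
  `|x - clip rho x| <= overshoot rho x.
Proof.
move=> r0; rewrite /overshoot; case: (ltP rho `|x|) => [h|].
  have := ler_norm x; have := ler_norm (- x); rewrite normrN => h1 h2.
  rewrite clipE// ler_norml.
  by case: (leP rho x) => ?; [|case: (leP x (- rho)) => ?]; lra.
rewrite ler_norml => /andP[h1 h2].
have -> : clip rho x = x.
  by rewrite clipE//; case: (leP rho x) => ?; [|case: (leP x (- rho)) => ?]; lra.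
by rewrite subrr normr0.
Qed.

Lemma overshoot_ge0 (R : realType) (rho x : R) : 0 <= overshoot rho x.
Proof. by rewrite /overshoot; case: ifP. Qed.

Lemma measurable_clip (R : realType) (rho : R) : measurable_fun setT (clip rho).
Proof.
rewrite /clip; apply: measurable_maxr; first exact: measurable_cst.
by apply: measurable_minr; [exact: measurable_cst|exact: measurable_id].
Qed.

Lemma measurable_overshoot (R : realType) (rho : R) :
  measurable_fun setT (overshoot rho).
Proof.
rewrite /overshoot; apply: measurable_fun_ifT.
- apply: measurable_fun_ltr; first exact: measurable_cst.
  exact: normr_measurable.
- exact: normr_measurable.
- exact: measurable_cst.
Qed.

(** With N twice the sample size, an observation of Orlicz scale L is clipped at
    the level rho for which exp (- (rho / L)^beta / 2) = 1 / N: few observations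
    exceed it, and it grows only like a power of ln N. *)
Definition clip_level (R : realType) (beta L N : R) : R :=
  L * (2 * ln N) `^ (1 / beta).

Section orlicz_pointwise.
Context {R : realType}.
Variables (beta L N : R).
Hypotheses (beta0 : 0 < beta) (L0 : 0 < L) (N2 : 2 <= N).

Let rho := clip_level beta L N.
Let M (x : R) := expR ((`|x| / L) `^ beta).

Let N0 : 0 < N. Proof. exact: lt_le_trans N2. Qed.

Lemma ln2_half : 1 <= 2 * ln 2 :> R.
Proof.
have e2 : expR (2^-1 : R) <= 2.
  have h : 1 - 2^-1 <= (expR (2^-1 : R))^-1.
    by rewrite -expRN; apply: le_trans (expR_ge1Dx _).
  have e0 := expR_gt0 (2^-1 : R).
  have {}h : expR (2^-1 : R) * (1 - 2^-1) <= 1.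
    by rewrite mulrC -ler_pdivlMr// mul1r.
  lra.
have : 2^-1 <= ln 2 :> R by rewrite -(@expRK _ 2^-1) ler_ln ?posrE ?expR_gt0.
lra.
Qed.

Lemma ln_ge_half : 1 <= 2 * ln N.
Proof.
by rewrite (le_trans ln2_half)// ler_pM2l// ler_ln ?posrE.
Qed.

Lemma clip_level_gt0 : 0 < rho.
Proof.
by rewrite /rho mulr_gt0// powR_gt0// (lt_le_trans _ ln_ge_half).
Qed.

(** Above the level, half of the exponent already pays for the factor 1 / N.
    The rescaled value exceeds one because 2 ln N >= 1; this is what makes the
    powers T1 beta and beta comparable. *)
Lemma above_level x : rho < `|x| ->
  expR ((`|x| / L) `^ beta / 2) <= M x / N /\ 1 <= `|x| / L.
Proof.
move=> hx.
have hL : (2 * ln N) `^ (1 / beta) < `|x| / L by rewrite ltr_pdivlMr// mulrC.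
have l1 := ln_ge_half.
have l0 : 0 <= 2 * ln N by lra.
have hb : 2 * ln N < (`|x| / L) `^ beta.
  have -> : 2 * ln N = ((2 * ln N) `^ (1 / beta)) `^ beta.
    by rewrite -powRrM divfK ?gt_eqF// powRr1.
  by rewrite gt0_ltr_powR ?nnegrE ?powR_ge0// divr_ge0// ltW.
split; last first.
  rewrite leNgt; apply/negP => x1.
  have : (`|x| / L) `^ beta <= 1.
    apply: (@le_trans _ _ (1 `^ beta)); last by rewrite powR1.
    by rewrite ge0_ler_powR ?nnegrE ?(ltW beta0) ?(ltW x1)// divr_ge0// ltW.
  lra.
rewrite /M ler_pdivlMr//.
have -> : N = expR (ln N) by rewrite lnK// posrE.
by rewrite -expRD ler_expR; lra.
Qed.

Lemma overshoot_powR_expR x :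
  expR (overshoot rho x `^ T1 beta / (2 * L `^ T1 beta)) <= 1 + M x / N.
Proof.
have g0 : 0 < T1 beta by rewrite /T1 lt_min beta0 ltr01.
rewrite /overshoot; case: ifP => [h|_]; last first.
  by rewrite powR0 ?gt_eqF// mul0r expR0 lerDl divr_ge0 ?expR_ge0// ltW.
have [hM h1] := above_level h.
rewrite (le_trans _ (le_trans hM _)) ?lerDr// ler_expR.
have -> : `|x| `^ T1 beta / (2 * L `^ T1 beta) = (`|x| / L) `^ T1 beta / 2.
  rewrite [X in X `^ _ / _](_ : _ = `|x| / L * L); last by rewrite divfK ?gt_eqF.
  rewrite powRM ?(ltW L0) ?divr_ge0 ?(ltW L0)//; field.
  by rewrite powR_eq0 gt_eqF//.
rewrite ler_pM2r ?invr_gt0//; apply: ler_powR => //.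
by rewrite /T1 ge_min lexx.
Qed.

Let powR_betaK y : 0 <= y -> (y `^ beta) `^ (1 / beta) = y.
Proof. by move=> y0; rewrite -powRrM [beta * _]mulrC divfK ?gt_eqF// powRr1. Qed.

Lemma abs_le_orlicz x : `|x| <= L * (2 / beta) `^ (1 / beta) * M x.
Proof.
have x0 : 0 <= `|x| / L by rewrite divr_ge0// ltW.
have := @powR_le_expR R (1 / beta) ((`|x| / L) `^ beta).
rewrite divr_gt0// powR_ge0 => /(_ isT isT).
rewrite powR_betaK// => h.
have {}h : `|x| / L <= (2 * (1 / beta)) `^ (1 / beta) * M x.
  apply: le_trans h _; apply: ler_wpM2l; first exact: powR_ge0.
  by rewrite ler_expR; have := powR_ge0 (`|x| / L) beta; lra.
rewrite -mulrA mulrC -ler_pdivrMr// (le_trans h)//.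
by rewrite mulrA mulr1.
Qed.

Lemma overshoot_le_orlicz x :
  overshoot rho x <= L * (2 / beta) `^ (1 / beta) * (M x / N).
Proof.
rewrite /overshoot; case: ifP => [h|_]; last first.
  by rewrite !mulr_ge0 ?powR_ge0 ?invr_ge0 ?expR_ge0 ?(ltW L0) ?(ltW N0).
have [hM h1] := above_level h.
have x0 : 0 <= `|x| / L by rewrite divr_ge0// ltW.
have := @powR_le_expR R (1 / beta) ((`|x| / L) `^ beta).
rewrite divr_gt0// powR_ge0 => /(_ isT isT).
rewrite powR_betaK// => h2.
rewrite -mulrA mulrC -ler_pdivrMr// (le_trans h2)//.
rewrite (_ : 2 * (1 / beta) = 2 / beta) ?mul1r//; apply: ler_wpM2l => //; exact: powR_ge0.
Qed.

Lemma sqr_le_orlicz x : x ^+ 2 <= (L * (4 / beta) `^ (1 / beta)) ^+ 2 * M x.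
Proof.
have x0 : 0 <= `|x| / L by rewrite divr_ge0// ltW.
have b2 : 0 < 1 / (beta / 2) by rewrite !divr_gt0.
have := powR_le_expR b2 (powR_ge0 (`|x| / L) beta).
have -> : 1 / (beta / 2) = 1 / beta * 2 by field; rewrite gt_eqF.
have -> : ((`|x| / L) `^ beta) `^ (1 / beta * 2) = (`|x| / L) ^+ 2.
  by rewrite powRrM powR_betaK// powR_mulrn.
rewrite powRrM powR_mulrn ?powR_ge0// => h.
have {}h : (`|x| / L) ^+ 2 <= ((4 / beta) `^ (1 / beta)) ^+ 2 * M x.
  apply: le_trans h _.
  have -> : 2 * (1 / beta * 2) = 4 / beta by field; rewrite gt_eqF.
  apply: ler_wpM2l; first exact: sqr_ge0.
  by rewrite ler_expR; have := powR_ge0 (`|x| / L) beta; lra.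
rewrite exprMn -mulrA mulrC -ler_pdivrMr ?exprn_gt0// (le_trans _ h)//.
by rewrite exprMn exprVn real_normK// num_real.
Qed.

End orlicz_pointwise.

(** * Exponential moments of clipped variables *)

Section real_integrals.
Context {R : realType} {d : measure_display} {T : measurableType d}.
Variable P : probability T R.
Implicit Types f g : T -> R.

Local Notation intg f := (P.-integrable setT (EFin \o f)).

Lemma prob_integrable_cst (c : R) : intg (fun=> c).
Proof. exact: finite_measure_integrable_cst. Qed.

Lemma prob_Rintegral_cst (c : R) : \int[P]_w c = c.
Proof.
rewrite Rintegral_cst// -[RHS]mulr1; congr (_ * _).
exact: (congr1 fine (probability_setT P)).
Qed.

Lemma Rintegrable_le f g : measurable_fun setT f ->
  (forall w, `|f w| <= g w) -> intg g -> intg f.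
Proof.
move=> mf fg ig; apply: (le_integrable _ _ _ ig) => //.
  exact/measurable_EFinP.
move=> w _ /=; rewrite lee_fin (le_trans (fg w))// ler_norm//.
Qed.

Lemma Rintegrable_scale (c : R) f : intg f -> intg (fun w => c * f w).
Proof. by move=> fi; exact: (integrableZl measurableT c fi). Qed.

Lemma Rintegrable_add f g : intg f -> intg g -> intg (fun w => f w + g w).
Proof. by move=> fi gi; exact: (integrableD measurableT fi gi). Qed.

Lemma Rintegral_EFin f : intg f ->
  (\int[P]_w (f w)%:E)%E = (\int[P]_w f w)%:E.
Proof. by move=> fi; rewrite /Rintegral fineK//; exact: integrable_fin_num. Qed.

Lemma Rintegrable_of_le f (D : R) : measurable_fun setT f ->
  (forall w, 0 <= f w) -> (\int[P]_w (f w)%:E <= D%:E)%E ->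
  intg f /\ \int[P]_w f w <= D.
Proof.
move=> mf f0 fD.
have fi : intg f.
  apply/integrableP; split; first exact/measurable_EFinP.
  rewrite (le_lt_trans _ (ltry D))// (le_trans _ fD)//.
  by under eq_integral do rewrite /= ger0_norm//.
by split => //; rewrite -lee_fin -Rintegral_EFin.
Qed.

Lemma integral_EFin_le f g : measurable_fun setT f -> measurable_fun setT g ->
  (forall w, 0 <= f w) -> (forall w, f w <= g w) ->
  (\int[P]_w (f w)%:E <= \int[P]_w (g w)%:E)%E.
Proof.
move=> mf mg f0 fg; apply: ge0_le_integral => //.
- by move=> w _; rewrite lee_fin.
- exact/measurable_EFinP.
- exact/measurable_EFinP.
- by move=> w _; rewrite lee_fin.
Qed.

Lemma Rintegral_le f g : intg f -> intg g ->
  (forall w, f w <= g w) -> \int[P]_w f w <= \int[P]_w g w.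
Proof. by move=> fi gi fg; apply: le_Rintegral. Qed.

(** Markov's inequality for the exponential moment. *)
Lemma chernoff_tail (S : T -> R) (a s : R) : measurable_fun setT S ->
  (\int[P]_w (expR (S w))%:E <= (expR a)%:E)%E ->
  (P [set w | a + s <= S w]%R <= (expR (- s))%:E)%E.
Proof.
move=> mS h.
set A := [set w | _].
have mA : measurable A.
  exact: measurable_superlevel.
have h2 : ((expR (a + s))%:E * P A <= (expR a)%:E)%E.
  apply: le_trans h.
  have -> : ((expR (a + s))%:E * P A =
      \int[P]_w ((expR (a + s))%:E * (\1_A w)%:E))%E.
    rewrite ge0_integralZl ?integral_indic ?setIT//.
    exact/measurable_EFinP/measurable_indic.
  apply: ge0_le_integral => //.
  - apply/measurable_EFinP; apply: measurable_funM; first exact: measurable_cst.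
    exact: measurable_indic.
  - apply/measurable_EFinP; exact: measurableT_comp.
  - move=> w _; rewrite -EFinM lee_fin indicE.
    have [wA|wA] := boolP (w \in A); last by rewrite mulr0 expR_ge0.
    by rewrite mulr1 ler_expR; move: wA; rewrite inE.
have -> : (expR (- s))%:E = ((expR (a + s))^-1%:E * (expR a)%:E)%E.
  by rewrite -EFinM -expRN -expRD; congr (expR _)%:E; ring.
rewrite muleC -lee_pdivrMr ?invr_gt0 ?expR_gt0// invrK muleC//.
Qed.

End real_integrals.

Section clipped_mgf.
Context {R : realType} {d : measure_display} {T : measurableType d}.
Variable P : probability T R.

Lemma integrable_clip (V : T -> R) (rho : R) : 0 <= rho ->
  measurable_fun setT V -> P.-integrable setT (EFin \o (clip rho \o V)).
Proof.
move=> r0 mV; apply: (Rintegrable_le (g := fun=> rho)).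
- by apply: measurableT_comp => //; exact: measurable_clip.
- by move=> w; exact: clip_norm_le.
- exact: prob_integrable_cst.
Qed.

(** Centring at the clipped mean rather than at the mean of the clipped variable
   lets the variance of the unclipped variable appear, clipping being a
   contraction. *)
Lemma clip_mgf (V : T -> R) (rho mu v lambda : R) : 0 < rho ->
  measurable_fun setT V -> 0 <= lambda -> lambda * (6 * rho) <= 1 ->
  (\int[P]_w ((V w - mu) ^+ 2)%:E <= v%:E)%E ->
  (\int[P]_w (expR (lambda * (clip rho (V w) - \int[P]_z clip rho (V z))))%:E
    <= (expR (lambda ^+ 2 * v))%:E)%E.
Proof.
move=> r0 mV l0 l6 hv.
pose B w := clip rho (V w); pose b := clip rho mu; pose EB := \int[P]_z B z.
have mB : measurable_fun setT B.
  by apply: measurableT_comp => //; exact: measurable_clip.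
have iB : P.-integrable setT (EFin \o B) by apply: integrable_clip => //; exact: ltW.
have Bb w : `|B w - b| <= 2 * rho.
  rewrite (le_trans (ler_normB _ _))// mulrDl mul1r lerD// clip_norm_le//; exact: ltW.
pose Q w := (B w - b) ^+ 2.
have mBb : measurable_fun setT (fun w => B w - b).
  by apply: measurable_funB => //; exact: measurable_cst.
have mQ : measurable_fun setT Q by exact: measurable_funX.
have [iQ EQ] : P.-integrable setT (EFin \o Q) /\ \int[P]_w Q w <= v.
  apply: Rintegrable_of_le => //; first by move=> w; exact: sqr_ge0.
  apply: le_trans hv; apply: integral_EFin_le => //.
  - apply: measurable_funX; apply: measurable_funB => //; exact: measurable_cst.
  - by move=> w; exact: sqr_ge0.
  - move=> w; rewrite /Q -[leLHS]real_normK ?num_real// -[leRHS]real_normK ?num_real//.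
    by rewrite lerXn2r ?nnegrE// clip_contract// ltW.
pose S w := (1 - lambda * b + lambda * B w) + lambda ^+ 2 * Q w.
have iS1 : P.-integrable setT (EFin \o (fun w => 1 - lambda * b + lambda * B w)).
  by apply: Rintegrable_add; [exact: prob_integrable_cst|exact: Rintegrable_scale].
have iS2 : P.-integrable setT (EFin \o (fun w => lambda ^+ 2 * Q w)).
  exact: Rintegrable_scale.
have iS : P.-integrable setT (EFin \o S) by exact: Rintegrable_add.
have ES : \int[P]_w S w <= expR (lambda * (EB - b) + lambda ^+ 2 * v).
  rewrite /S RintegralD// RintegralD//; last 2 first.
  - exact: prob_integrable_cst.
  - exact: Rintegrable_scale.
  rewrite !RintegralZl// prob_Rintegral_cst -/EB.
  apply: le_trans (expR_ge1Dx _).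
  have := ler_wpM2l (sqr_ge0 lambda) EQ.
  set q := \int[P]_w Q w; lra.
pose c := expR (lambda * (b - EB)).
have mE : measurable_fun setT (fun w => expR (lambda * (B w - EB))).
  apply: measurableT_comp => //; apply: measurable_funM; first exact: measurable_cst.
  by apply: measurable_funB => //; exact: measurable_cst.
apply: (@le_trans _ _ (\int[P]_w (c * S w)%:E)%E).
  apply: integral_EFin_le => //.
  - apply: measurable_funM; first exact: measurable_cst.
    by have /measurable_int/measurable_EFinP := iS.
  - move=> w.
    have -> : lambda * (B w - EB) = lambda * (b - EB) + lambda * (B w - b) by ring.
    rewrite expRD; apply: ler_wpM2l; first exact: expR_ge0.
    have -> : S w = 1 + lambda * (B w - b) + (lambda * (B w - b)) ^+ 2.
      rewrite /S /Q; ring.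
    apply: expR_le_quadratic; rewrite normrM ger0_norm//.
    have := ler_wpM2l l0 (Bb w); lra.
under eq_integral do rewrite EFinM.
rewrite integralZl// Rintegral_EFin// -EFinM lee_fin.
apply: (le_trans (ler_wpM2l (expR_ge0 _) ES)).
by rewrite /c -expRD ler_expR le_eqVlt; apply/orP; left; apply/eqP; ring.
Qed.

End clipped_mgf.

(** * Concentration of sums with heavy tails *)

(** The three summands account for the clipped part, the overshoots and the bias
    of the clipped means; the prefactor extracts the 2 of (2 ln N)^(1 / beta). *)
Definition conc_const (R : realType) (beta : R) : R :=
  2 `^ (1 / beta) * (6 + 4 `^ (1 / T1 beta) + (2 / beta) `^ (1 / beta)).

Section concentration.
Context {R : realType} {d : measure_display} {T : measurableType d}.
Variables (P : probability T R) (n : nat) (V : 'I_n -> T -> R).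
Hypothesis mV : forall i, measurable_fun setT (V i).
Hypothesis indV : independent_family P V.

Lemma integral_expR_sum (f : 'I_n -> R -> R) (a : 'I_n -> R) :
  (forall i, measurable_fun setT (f i)) ->
  (forall i, (\int[P]_w (expR (f i (V i w)))%:E <= (expR (a i))%:E)%E) ->
  (\int[P]_w (expR (\sum_i f i (V i w)))%:E <= (expR (\sum_i a i))%:E)%E.
Proof.
move=> mf fa.
under eq_integral do rewrite expR_sum.
rewrite (integral_prod_independent (f := fun i x => expR (f i x)) mV indV).
- rewrite expR_sum -prodEFin.
  suff [] : (0 <= \prod_i \int[P]_w (expR (f i (V i w)))%:E)%E /\
    (\prod_i \int[P]_w (expR (f i (V i w)))%:E <= \prod_i (expR (a i))%:E)%E by [].
  apply: (big_ind2 (fun x y => (0 <= x)%E /\ (x <= y)%E)).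
  + by split.
  + by move=> x1 x2 y1 y2 [? ?] [? ?]; split; [exact: mule_ge0|exact: lee_pmul].
  + move=> i _; split => //; apply: integral_ge0 => w _.
    by rewrite lee_fin expR_ge0.
- by move=> i; exact: measurableT_comp.
- by move=> i z; exact: expR_ge0.
- by move=> i; rewrite (le_lt_trans (fa i))// ltry.
Qed.

Lemma variance_integral (X : T -> R) :
  'V_P[X] = (\int[P]_w ((X w - fine 'E_P[X]) ^+ 2)%:E)%E.
Proof. by rewrite /variance unlock unlock; apply: eq_integral. Qed.

Variables (beta L D s v : R).
Hypotheses (n0 : (0 < n)%N) (beta0 : 0 < beta) (L0 : 0 < L).
Hypothesis orl : forall i,
  (\int[P]_w (expR ((`|V i w| / L) `^ beta))%:E <= D%:E)%E.
Hypotheses (s1 : 1 <= s) (Ds : D <= 2 * s).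
Hypothesis varV : (\sum_i 'V_P[V i] <= v%:E)%E.

Let N : R := 2 * n%:R.
Let N2 : 2 <= N. Proof. by rewrite /N ler_peMr// ler1n. Qed.
Let N0 : 0 < N. Proof. exact: lt_le_trans N2. Qed.
Let rho := clip_level beta L N.
Let rho0 : 0 < rho. Proof. exact: clip_level_gt0. Qed.
Let g := T1 beta.
Let g0 : 0 < g. Proof. by rewrite /g /T1 lt_min beta0 ltr01. Qed.
Let g1 : g <= 1. Proof. by rewrite /g /T1 ge_min lexx orbT. Qed.
Let M i w := expR ((`|V i w| / L) `^ beta).

Let mM i : measurable_fun setT (M i).
Proof.
apply: measurableT_comp => //; apply: measurable_fun_powR.
apply: measurable_funM; last exact: measurable_cst.
exact: measurableT_comp.
Qed.

Let M0 i w : 0 <= M i w. Proof. exact: expR_ge0. Qed.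

Let meanB i := \int[P]_z clip rho (V i z).

Let bernstein_event (lambda : R) :
  0 <= lambda -> lambda * (6 * rho) <= 1 ->
  (P [set w | lambda ^+ 2 * v + s <=
     \sum_i lambda * (clip rho (V i w) - meanB i)]%R <= (expR (- s))%:E)%E.
Proof.
move=> l0 l6.
have v0 i : (0 <= 'V_P[V i])%E by exact: variance_ge0.
have vfin i : ('V_P[V i] = (fine 'V_P[V i])%:E)%E.
  rewrite fineK// ge0_fin_numE// (le_lt_trans _ (ltry v))//.
  apply: le_trans varV; rewrite (bigD1 i)//= leeDl// sume_ge0//.
have vsum : \sum_i fine 'V_P[V i] <= v.
  by rewrite -lee_fin -sumEFin (le_trans _ varV)// lee_sum// => i _; rewrite -vfin.
apply: chernoff_tail.
  apply: measurable_fun_bigsum => i; apply: measurable_funM; first exact: measurable_cst.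
  apply: measurable_funB; last exact: measurable_cst.
  by apply: measurableT_comp => //; exact: measurable_clip.
apply: (@le_trans _ _ (expR (\sum_i lambda ^+ 2 * fine 'V_P[V i]))%:E).
  apply: (integral_expR_sum (f := fun i x => lambda * (clip rho x - meanB i))).
  - move=> i; apply: measurable_funM; first exact: measurable_cst.
    apply: measurable_funB; last exact: measurable_cst.
    exact: measurable_clip.
  - move=> i; apply: (clip_mgf (mu := fine 'E_P[V i])) => //.
    by rewrite -variance_integral -vfin.
by rewrite lee_fin ler_expR -mulr_sumr ler_wpM2l// sqr_ge0.
Qed.

Let nN : n%:R * N^-1 = 2^-1.
Proof. by rewrite /N; field; rewrite pnatr_eq0 -lt0n. Qed.

Let tail_event :
  (P [set w | D / 2 + s <=
     \sum_i overshoot rho (V i w) `^ g / (2 * L `^ g)]%R <= (expR (- s))%:E)%E.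
Proof.
have mt : measurable_fun setT (fun x => overshoot rho x `^ g / (2 * L `^ g)).
  apply: measurable_funM; last exact: measurable_cst.
  apply: measurable_fun_powR; exact: measurable_overshoot.
apply: chernoff_tail.
  by apply: measurable_fun_bigsum => i; exact: (measurableT_comp mt).
have -> : D / 2 = \sum_(i < n) D / N.
  by rewrite sumr_const card_ord -[RHS]mulr_natl mulrCA nN.
apply: (integral_expR_sum (f := fun i x => overshoot rho x `^ g / (2 * L `^ g))) => // i.
have [iM EM] := Rintegrable_of_le (mM i) (M0 i) (orl i).
apply: (@le_trans _ _ (\int[P]_w (1 + N^-1 * M i w)%:E)%E).
  apply: integral_EFin_le.
  - by apply: measurableT_comp => //; exact: (measurableT_comp mt).
  - apply: measurable_funD; first exact: measurable_cst.
    by apply: measurable_funM => //; exact: measurable_cst.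
  - by move=> w; exact: expR_ge0.
  - by move=> w; rewrite [N^-1 * _]mulrC overshoot_powR_expR.
have iNM : P.-integrable setT (EFin \o (fun w => N^-1 * M i w)) by exact: Rintegrable_scale.
have i1 : P.-integrable setT (EFin \o (fun _ : T => 1 : R)) by exact: prob_integrable_cst.
rewrite Rintegral_EFin; last exact: Rintegrable_add.
rewrite RintegralD// RintegralZl// prob_Rintegral_cst lee_fin.
rewrite (le_trans _ (expR_ge1Dx _))// lerD2l mulrC ler_pM2r ?invr_gt0//.
Qed.

(** The bias of clipping is of order 1 / N, so that its sum over the sample is
    bounded. *)
Let mean_overshoot i :
  `|fine 'E_P[V i] - meanB i| <= L * (2 / beta) `^ (1 / beta) * (D / N).
Proof.
have [iM EM] := Rintegrable_of_le (mM i) (M0 i) (orl i).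
have iV : P.-integrable setT (EFin \o V i).
  apply: Rintegrable_le (Rintegrable_scale (L * (2 / beta) `^ (1 / beta)) iM) => //.
  by move=> w; exact: abs_le_orlicz.
have iB : P.-integrable setT (EFin \o (fun w => clip rho (V i w))).
  by apply: integrable_clip => //; exact: ltW.
have -> : fine 'E_P[V i] = \int[P]_w V i w by rewrite unlock.
rewrite /meanB -RintegralB//.
apply: le_trans (le_normr_Rintegral _ _) _ => //.
  exact: (integrableB measurableT iV iB).
apply: (@le_trans _ _ (\int[P]_w (L * (2 / beta) `^ (1 / beta) / N * M i w))).
  apply: Rintegral_le.
  - apply: (integrable_norm (integrableB measurableT iV iB)).
  - exact: Rintegrable_scale.
  - move=> w; rewrite (le_trans (clip_overshoot _ (ltW rho0)))//.
    by rewrite -mulrA [N^-1 * _]mulrC overshoot_le_orlicz.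
rewrite RintegralZl// -mulrA; apply: ler_wpM2l.
  by rewrite mulr_ge0 ?powR_ge0 ?(ltW L0).
by rewrite mulrC ler_pM2r ?invr_gt0.
Qed.

(** Choice of the Chernoff parameter: 1 / lambda is the Gaussian scale
    sqrt (v / s) plus the smallest value for which the quadratic bound on exp
    covers the whole range of the clipped summands. *)
Let bernstein_level :
  exists2 lambda : R, 0 < lambda & lambda * (6 * rho) <= 1 /\
    lambda ^+ 2 * v + s <= lambda * (2 * Num.sqrt (v * s) + 6 * rho * s).
Proof.
have v0 : 0 <= v.
  rewrite -lee_fin (le_trans _ varV)// sume_ge0// => i _; exact: variance_ge0.
have s0 : 0 < s by exact: lt_le_trans s1.
set a := Num.sqrt v; set b := Num.sqrt s.
have a0 : 0 <= a by exact: sqrtr_ge0.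
have b0 : 0 < b by rewrite sqrtr_gt0.
have va : v = a ^+ 2 by rewrite sqr_sqrtr.
have sb : s = b ^+ 2 by rewrite sqr_sqrtr// ltW.
have -> : Num.sqrt (v * s) = a * b by rewrite sqrtrM.
pose m := 6 * rho + a / b.
have ab0 : 0 <= a / b by rewrite divr_ge0// ltW.
have r0 := rho0.
have m0 : 0 < m by rewrite /m; lra.
exists m^-1; first by rewrite invr_gt0.
have mab : a / b <= m by rewrite /m; lra.
split; first by rewrite mulrC ler_pdivrMr// mul1r /m; lra.
have -> : m^-1 ^+ 2 * v + s = m^-1 * (m^-1 * v + s * m) by field; rewrite gt_eqF.
apply: ler_wpM2l; first by rewrite invr_ge0 ltW.
have -> : s * m = 6 * rho * s + a * b by rewrite /m {2}sb {1}sb; field; rewrite gt_eqF.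
have : m^-1 * v <= a * b.
  rewrite mulrC ler_pdivrMr// va.
  have -> : a ^+ 2 = a * b * (a / b) by field; rewrite gt_eqF.
  by apply: ler_wpM2l => //; rewrite mulr_ge0// ltW.
lra.
Qed.

(** Bernstein's inequality with the true variances and an additive term for the
    heavy tails: the clipped summands are bounded and concentrate at the
    Gaussian scale, while the sum of the overshoots is controlled through its
    quasi-norm of exponent min (beta, 1), whose terms are exponentially
    integrable and rarely nonzero. *)
Lemma concentration :
  (P [set w | 2 * Num.sqrt (v * s)
       + conc_const beta * (L * (ln N `^ (1 / beta) * s `^ (1 / g)))
       < \sum_i (V i w - fine ('E_P[V i])%E)]%R <= (2 * expR (- s))%:E)%E.
Proof.
have [lambda l0 [l6 hl]] := bernstein_level.
set E0 := [set w | _].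
pose A1 := [set w | lambda ^+ 2 * v + s <=
     \sum_i lambda * (clip rho (V i w) - meanB i)].
pose A2 := [set w | D / 2 + s <=
     \sum_i overshoot rho (V i w) `^ g / (2 * L `^ g)].
have mO : measurable_fun setT (fun x => overshoot rho x `^ g / (2 * L `^ g)).
  apply: measurable_funM; last exact: measurable_cst.
  apply: measurable_fun_powR; exact: measurable_overshoot.
have mA1 : measurable A1.
  apply: measurable_superlevel; apply: measurable_fun_bigsum => i.
  apply: measurable_funM; first exact: measurable_cst.
  apply: measurable_funB; last exact: measurable_cst.
  by apply: measurableT_comp => //; exact: measurable_clip.
have mA2 : measurable A2.
  by apply: measurable_superlevel; apply: measurable_fun_bigsum => i; exact: (measurableT_comp mO).
have mE0 : measurable E0.
  apply: measurable_strict_superlevel; apply: measurable_fun_bigsum => i.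
  by apply: measurable_funB => //; exact: measurable_cst.
apply: (@le_trans _ _ (P (A1 `|` A2))); last first.
  apply: (le_trans (measureU2 _ _ _)) => //.
  have -> : 2 * expR (- s) = expR (- s) + expR (- s) by ring.
  rewrite EFinD; apply: leeD; last exact: tail_event.
  by apply: bernstein_event => //; exact: ltW.
apply: le_measure; rewrite ?inE//; first exact: measurableU.
move=> w /= wE; apply: contrapT => /not_orP[].
move=> /negP; rewrite -ltNge => h1 /negP; rewrite -ltNge => h2.
move: wE; apply/negP; rewrite -leNgt.
have {}h1 : \sum_i (clip rho (V i w) - meanB i) <=
    2 * Num.sqrt (v * s) + 6 * rho * s.
  rewrite -(ler_pM2l l0) mulr_sumr; exact: le_trans (ltW h1) hl.
have s0 : 0 < s by exact: lt_le_trans s1.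
have Lg : 0 < L `^ g by exact: powR_gt0.
have g00 : 0 <= g^-1 by rewrite invr_ge0 ltW.
have {}h2 : \sum_i overshoot rho (V i w) <= L * (4 `^ (1 / g) * s `^ (1 / g)).
  apply: (le_trans (sum_le_powR _ g0 g1 _)); first by move=> i; exact: overshoot_ge0.
  have -> : L * (4 `^ (1 / g) * s `^ (1 / g)) = (4 * L `^ g * s) `^ (1 / g).
    rewrite !powRM ?mulr_ge0 ?(ltW s0) ?(ltW Lg)// -powRrM div1r mulfV ?gt_eqF//.
    rewrite powRr1 ?(ltW L0)//; ring.
  rewrite ge0_ler_powR ?nnegrE ?div1r//.
  - by apply: sumr_ge0 => i _; exact: powR_ge0.
  - by rewrite !mulr_ge0 ?(ltW s0) ?(ltW Lg).
  - have : \sum_i overshoot rho (V i w) `^ g <= (D / 2 + s) * (2 * L `^ g).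
      rewrite -ler_pdivrMr ?mulr_gt0// mulr_suml; exact: ltW.
    move=> /le_trans; apply.
    have -> : 4 * L `^ g * s = (2 * s) * (2 * L `^ g) by ring.
    by rewrite ler_pM2r ?mulr_gt0//; have := Ds; lra.
(* Deviation of the clipped variable, overshoot, bias of the clipped mean. *)
have h3 : \sum_i (V i w - fine ('E_P[V i])%E) <=
  \sum_i (clip rho (V i w) - meanB i) + \sum_i overshoot rho (V i w)
  + \sum_(i < n) L * (2 / beta) `^ (1 / beta) * (D / N).
  rewrite -!big_split/=; apply: ler_sum => i _.
  have := clip_overshoot (V i w) (ltW rho0); have := mean_overshoot i.
  by rewrite !ler_norml => /andP[? ?] /andP[? ?]; lra.
have {}h3 := le_trans h3 (lerD (lerD h1 h2) (lexx _)).
apply: (le_trans h3).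
rewrite sumr_const card_ord -[X in _ + X]mulr_natl.
set q := (2 / beta) `^ (1 / beta); set f4 := 4 `^ (1 / g).
set S := s `^ (1 / g).
have sS : s <= S by apply: le1r_powR => //; rewrite div1r invf_ge1.
set c := 2 `^ (1 / beta); set l := ln N `^ (1 / beta).
have lN : 1 <= 2 * ln N by exact: ln_ge_half.
have cl : c * l = (2 * ln N) `^ (1 / beta) by rewrite powRM//; lra.
have cl1 : 1 <= c * l.
  rewrite cl; apply: (@le_trans _ _ (1 `^ (1 / beta))); first by rewrite powR1.
  by rewrite ge0_ler_powR ?nnegrE ?divr_ge0 ?(ltW beta0)//; lra.
have rhoE : rho = L * (c * l) by rewrite cl.
have q0 : 0 <= q by exact: powR_ge0.
have f0 : 0 <= f4 by exact: powR_ge0.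
have S0 : 0 <= S by exact: powR_ge0.
have -> : n%:R * (L * q * (D / N)) = L * q * (D / 2).
  by rewrite -nN; ring.
have -> : conc_const beta = c * (6 + f4 + q) by [].
(* s <= S and 1 <= c * l bring the three terms to the form L * (c * l) * S. *)
rewrite rhoE -!addrA lerD2l.
have k1 : L * (c * l) * s <= L * (c * l) * S.
  by apply: ler_wpM2l => //; rewrite mulr_ge0 ?(ltW L0)//; lra.
have k2 : L * (f4 * S) * 1 <= L * (f4 * S) * (c * l).
  by apply: ler_wpM2l => //; rewrite !mulr_ge0 ?(ltW L0).
have k3 : L * q * (D / 2) <= L * q * S.
  by apply: ler_wpM2l; [rewrite mulr_ge0 ?(ltW L0)|have := Ds; lra].
have k4 : L * q * S * 1 <= L * q * S * (c * l).
  by apply: ler_wpM2l => //; rewrite !mulr_ge0 ?(ltW L0).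
nra.
Qed.

End concentration.

(** * Euclidean geometry of sparse vectors and their grid *)

Section euclidean_geometry.
Context {R : realType}.

Lemma dotvE m (u v : 'cV[R]_m) : dotv u v = \sum_j u j 0 * v j 0.
Proof. by rewrite /dotv mxE; apply: eq_bigr => j _; rewrite mxE. Qed.

Lemma dotvC m (u v : 'cV[R]_m) : dotv u v = dotv v u.
Proof. by rewrite !dotvE; apply: eq_bigr => j _; rewrite mulrC. Qed.

Lemma dotvDl m (u u' v : 'cV[R]_m) : dotv (u + u') v = dotv u v + dotv u' v.
Proof. by rewrite /dotv linearD/= mulmxDl mxE. Qed.

Lemma dotvZl m (a : R) (u v : 'cV[R]_m) : dotv (a *: u) v = a * dotv u v.
Proof. by rewrite /dotv linearZ/= -scalemxAl mxE. Qed.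

Lemma dotvNl m (u v : 'cV[R]_m) : dotv (- u) v = - dotv u v.
Proof. by rewrite -scaleN1r dotvZl mulN1r. Qed.

Lemma dotvDr m (u v v' : 'cV[R]_m) : dotv u (v + v') = dotv u v + dotv u v'.
Proof. by rewrite /dotv mulmxDr mxE. Qed.

Lemma dotvZr m (a : R) (u v : 'cV[R]_m) : dotv u (a *: v) = a * dotv u v.
Proof. by rewrite dotvC dotvZl dotvC. Qed.

Lemma dotvNr m (u v : 'cV[R]_m) : dotv u (- v) = - dotv u v.
Proof. by rewrite dotvC dotvNl dotvC. Qed.

Lemma l2norm_ge0 m (v : 'cV[R]_m) : 0 <= l2norm v.
Proof. exact: sqrtr_ge0. Qed.

Lemma sqr_l2norm m (v : 'cV[R]_m) : l2norm v ^+ 2 = dotv v v.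
Proof.
rewrite /l2norm sqr_sqrtr; last by apply: sumr_ge0 => j _; exact: sqr_ge0.
by rewrite dotvE; apply: eq_bigr => j _; rewrite expr2.
Qed.

Lemma l2norm_eq0 m (v : 'cV[R]_m) : l2norm v = 0 -> v = 0.
Proof.
move=> v0; have := sqr_l2norm v; rewrite v0 expr0n/= dotvE => /esym/eqP.
rewrite psumr_eq0; last by move=> j _; rewrite -expr2 sqr_ge0.
move=> /allP h; apply/colP => j; rewrite mxE.
by have := h j (mem_index_enum _); rewrite /= mulf_eq0 orbb => /eqP.
Qed.

Lemma l2normZ m (a : R) (v : 'cV[R]_m) : l2norm (a *: v) = `|a| * l2norm v.
Proof.
apply/eqP; rewrite -(@eqrXn2 _ 2)// ?mulr_ge0 ?l2norm_ge0//; apply/eqP.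
by rewrite exprMn !sqr_l2norm dotvZl dotvZr real_normK ?num_real//; ring.
Qed.

Lemma l2norm0 m : l2norm (0 : 'cV[R]_m) = 0.
Proof. by rewrite -[X in l2norm X](scale0r 0) l2normZ normr0 mul0r. Qed.

(** Cauchy-Schwarz, from 0 <= |b u - a v|^2 with a and b the two norms. *)
Lemma dotv_le m (u v : 'cV[R]_m) : dotv u v <= l2norm u * l2norm v.
Proof.
set a := l2norm u; set b := l2norm v.
have a0 : 0 <= a by exact: l2norm_ge0.
have b0 : 0 <= b by exact: l2norm_ge0.
have := sqr_ge0 (l2norm (b *: u - a *: v)).
rewrite sqr_l2norm dotvDl !dotvDr !dotvNl !dotvNr !dotvZl !dotvZr.
rewrite -!sqr_l2norm -/a -/b (dotvC v u) => h.
have [ab0|ab0] := ltP 0 (a * b).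
  by rewrite -(ler_pM2l ab0); lra.
have /eqP : a * b = 0 by apply/eqP; rewrite eq_le ab0 mulr_ge0.
rewrite mulf_eq0 => /orP[] /eqP e.
  by rewrite (l2norm_eq0 e) /dotv trmx0 mul0mx mxE e mul0r.
by rewrite (l2norm_eq0 e) /dotv mulmx0 mxE e mulr0.
Qed.

Lemma l2norm_triangle m (u v : 'cV[R]_m) : l2norm (u + v) <= l2norm u + l2norm v.
Proof.
rewrite -(@ler_pXn2r _ 2)// ?nnegrE ?addr_ge0 ?l2norm_ge0//.
rewrite sqr_l2norm dotvDl !dotvDr -!sqr_l2norm (dotvC v u).
by have := dotv_le u v; lra.
Qed.

Lemma abs_coord_le m (u : 'cV[R]_m) j : `|u j 0| <= l2norm u.
Proof.
rewrite -[leLHS]ger0_norm// -sqrtr_sqr ler_wsqrtr// (bigD1 j)//=.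
by rewrite real_normK ?num_real// lerDl sumr_ge0// => i _; exact: sqr_ge0.
Qed.

Lemma l2norm_le_l1 m (u : 'cV[R]_m) : l2norm u <= \sum_j `|u j 0|.
Proof.
rewrite -(@ler_pXn2r _ 2)// ?nnegrE ?l2norm_ge0 ?sumr_ge0//.
rewrite sqr_l2norm dotvE [leRHS]expr2 mulr_suml ler_sum// => j _.
rewrite -[leLHS]expr2 -[leLHS]real_normK ?num_real// expr2 ler_wpM2l//.
by rewrite (bigD1 j)//= lerDl sumr_ge0.
Qed.

Lemma l2norm_mulmx_le m (A : 'M[R]_m) (u : 'cV[R]_m) : 
  l2norm (A *m u) <= (\sum_i \sum_j `|A i j|) * l2norm u.
Proof.
apply: (le_trans (l2norm_le_l1 _)); rewrite mulr_suml ler_sum// => i _.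
rewrite mxE (le_trans (ler_norm_sum _ _ _))// mulr_suml ler_sum// => j _.
by rewrite normrM ler_wpM2l// abs_coord_le.
Qed.

Definition supported p (S : {set 'I_p}) (v : 'cV[R]_p) :=
  forall j, j \notin S -> v j 0 = 0.

Lemma supported_l0norm p (S : {set 'I_p}) (v : 'cV[R]_p) :
  supported S v -> (l0norm v <= #|S|)%N.
Proof.
move=> h; apply: subset_leq_card; apply/fintype.subsetP => j.
by rewrite inE; apply: contraNT => /h ->.
Qed.

Lemma supported_supp p (v : 'cV[R]_p) : supported [set j | v j 0 != 0]%SET v.
Proof. by move=> j; rewrite inE negbK => /eqP. Qed.

Lemma card_supp p (v : 'cV[R]_p) : #|[set j | v j 0 != 0]%SET| = l0norm v.
Proof. by rewrite cardsE. Qed.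

Lemma supportedD p (S : {set 'I_p}) (u v : 'cV[R]_p) :
  supported S u -> supported S v -> supported S (u + v).
Proof. by move=> hu hv j jS; rewrite mxE hu// hv// addr0. Qed.

Lemma supportedZ p (S : {set 'I_p}) (a : R) (v : 'cV[R]_p) :
  supported S v -> supported S (a *: v).
Proof. by move=> hv j jS; rewrite mxE hv// mulr0. Qed.

Lemma supportedN p (S : {set 'I_p}) (v : 'cV[R]_p) :
  supported S v -> supported S (- v).
Proof. by move=> hv j jS; rewrite mxE hv// oppr0. Qed.

Lemma supported_Theta p k (S : {set 'I_p}) (v : 'cV[R]_p) :
  (#|S| <= k)%N -> supported S v -> l2norm v <= 1 -> Theta p k v.
Proof. by move=> Sk Sv v1; split => //; exact: leq_trans (supported_l0norm Sv) Sk. Qed.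

End euclidean_geometry.

Section grid_net.
Context {R : realType}.
Variables (p k q : nat).
Hypotheses (k0 : (0 < k)%N) (q0 : (0 < q)%N).

(** k coordinates that are each off by one mesh make an error 1 / q in Euclidean
    norm. *)
Definition mesh : R := (q%:R * Num.sqrt k%:R)^-1.

(** The two copies of each coordinate carry its positive and negative parts, so
    that the zero coordinate has a single code. *)
Definition grid_code := {ffun 'I_p * bool -> 'I_(q * k).+1}.

Definition grid_point (f : grid_code) : 'cV[R]_p :=
  \col_j (mesh * ((f (j, true))%:R - (f (j, false))%:R)).

(** The constraint on the sum keeps the net small and loses no rounding: by
    Cauchy-Schwarz a k-sparse vector of norm at most 1 has l1 norm at most
    sqrt k, which is q k meshes. *)
Definition net : {set grid_code} :=
  [set f : grid_code | (\sum_x f x <= q * k)%N && `[< Theta p k (grid_point f) >]]%SET.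

Let sk0 : 0 < Num.sqrt (k%:R : R).
Proof. by rewrite sqrtr_gt0 ltr0n. Qed.

Let mesh0 : 0 < mesh.
Proof. by rewrite invr_gt0 mulr_gt0 ?ltr0n. Qed.

Lemma sparse_l1_le (S : {set 'I_p}) (v : 'cV[R]_p) : supported S v ->
  \sum_j `|v j 0| <= Num.sqrt (#|S|%:R) * l2norm v.
Proof.
move=> Sv.
have := dotv_le (\col_j (j \in S)%:R) (\col_j `|v j 0|).
congr (_ <= _).
  rewrite dotvE; apply: eq_bigr => j _; rewrite !mxE.
  by have [jS|jS] := boolP (j \in S); [rewrite mul1r|rewrite Sv// normr0 mulr0].
congr (_ * _); congr Num.sqrt.
  under eq_bigr => j _.
    rewrite mxE (_ : _ ^+ 2 = (j \in S)%:R); last by case: (j \in S); rewrite ?expr1n ?expr0n.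
    over.
  by rewrite -natr_sum -big_mkcond/= sum1_card.
by apply: eq_bigr => j _; rewrite mxE real_normK ?num_real.
Qed.

(** Rounding toward zero, as opposed to rounding to the nearest point, creates no
    coordinate and does not increase the norm, so the result stays in Theta. *)
Lemma grid_approx (theta : 'cV[R]_p) : Theta p k theta ->
  exists2 f, f \in net &
    supported [set j | theta j 0 != 0]%SET (grid_point f) /\
    l2norm (theta - grid_point f) <= q%:R^-1.
Proof.
move=> [t0 t1]; set S := [set j | _]%SET.
have Sk : (#|S| <= k)%N by rewrite card_supp.
have St : supported S theta by exact: supported_supp.
pose a j := `|theta j 0| / mesh.
have a0 j : 0 <= a j by rewrite divr_ge0// ltW.
have ta j : (Num.truncn (a j))%:R <= a j /\ a j <= (Num.truncn (a j))%:R + 1.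
  by have /andP[-> /ltW] := truncn_itv (a0 j); rewrite -natr1.
have l1 : \sum_j a j <= (q * k)%:R.
  rewrite -mulr_suml ler_pdivrMr//.
  apply: le_trans (sparse_l1_le St) _.
  rewrite /mesh natrM -[X in _ * X / _](sqr_sqrtr (ler0n _ k)).
  have -> : q%:R * Num.sqrt k%:R ^+ 2 / (q%:R * Num.sqrt k%:R) = Num.sqrt k%:R :> R.
    by field; rewrite pnatr_eq0 -lt0n q0 gt_eqF.
  rewrite -[leRHS]mulr1 ler_pM ?sqrtr_ge0 ?l2norm_ge0//.
  by rewrite ler_wsqrtr// ler_nat.
have sumt : (\sum_j Num.truncn (a j) <= q * k)%N.
  rewrite -(ler_nat R) natr_sum (le_trans _ l1)// ler_sum// => j _.
  by have [] := ta j.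
have tj j : (Num.truncn (a j) < (q * k).+1)%N.
  by rewrite ltnS (leq_trans _ sumt)// (bigD1 j)//= leq_addr.
pose f : grid_code := [ffun x : 'I_p * bool =>
  if x.2 == (0 <= theta x.1 0) then inord (Num.truncn (a x.1)) else ord0].
have fE j : grid_point f j 0 =
    mesh * (if 0 <= theta j 0 then (Num.truncn (a j))%:R else - (Num.truncn (a j))%:R).
  rewrite !mxE !ffunE/=; congr (_ * _).
  by case: (0 <= theta j 0) => /=; rewrite inordK ?subr0 ?sub0r.
have thE j : theta j 0 = mesh * (if 0 <= theta j 0 then a j else - a j).
  rewrite /a; case: ger0P => h; rewrite ?mulrN mulrC divfK ?gt_eqF//.
  by rewrite opprK.
have Sf : supported S (grid_point f).
  move=> j jS; rewrite fE; have -> : Num.truncn (a j) = 0%N.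
    by rewrite /a St// normr0 mul0r truncn0.
  by case: ifP; rewrite ?oppr0 mulr0.
have fle j : `|grid_point f j 0| <= `|theta j 0|.
  rewrite fE [X in _ <= `|X|]thE !normrM ler_wpM2l//.
  have [h1 h2] := ta j.
  by case: ifP => _; rewrite ?normrN !ger0_norm.
have fdist j : `|theta j 0 - grid_point f j 0| <= mesh * (j \in S)%:R.
  have [jS|jS] := boolP (j \in S); last first.
    by rewrite St// Sf// subrr normr0 mulr0.
  rewrite mulr1 fE [X in `|X - _|]thE -mulrBr normrM (gtr0_norm mesh0).
  rewrite -[leRHS]mulr1 ler_wpM2l ?(ltW mesh0)//.
  have [h1 h2] := ta j.
  by case: ifP => _; rewrite ler_norml; lra.
have f1 : l2norm (grid_point f) <= 1.
  apply: le_trans t1; apply: ler_wsqrtr; apply: ler_sum => j _.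
  by rewrite -[leLHS]real_normK ?num_real// -[leRHS]real_normK ?num_real// lerXn2r ?nnegrE.
exists f.
  rewrite inE; apply/andP; split; last first.
    by apply/asboolP; apply: supported_Theta Sk Sf f1.
  rewrite (leq_trans _ sumt)//.
  have -> : (\sum_x f x = \sum_j \sum_b (f (j, b) : nat))%N.
    by rewrite pair_bigA/=; apply: eq_bigr => -[].
  apply: leq_sum => j _; rewrite big_bool/= !ffunE/=.
  by case: (0 <= theta j 0) => /=; rewrite inordK ?addn0.
split => //.
have -> : q%:R^-1 = Num.sqrt (k%:R * mesh ^+ 2) :> R.
  rewrite sqrtrM// sqrtr_sqr gtr0_norm// /mesh; field.
  by rewrite pnatr_eq0 -lt0n q0 gt_eqF.
apply: ler_wsqrtr.
apply: (@le_trans _ _ (\sum_(j < p) mesh ^+ 2 * (j \in S)%:R)).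
  apply: ler_sum => j _; rewrite !mxE in fdist *.
  rewrite -[leLHS]real_normK ?num_real//.
  have -> : mesh ^+ 2 * (j \in S)%:R = (mesh * (j \in S)%:R) ^+ 2.
    by rewrite exprMn; case: (j \in S); rewrite ?expr1n ?expr0n.
  rewrite lerXn2r ?nnegrE// ?mulr_ge0 ?(ltW mesh0)//.
  by have := fdist j; rewrite !mxE.
rewrite -mulr_sumr -natr_sum -big_mkcond/= sum1_card mulrC.
by rewrite ler_wpM2r ?sqr_ge0// ler_nat.
Qed.

End grid_net.

(** * Size of the net and passage from the net to all sparse vectors *)

(** When a code is weighted by x to the power of its sum, the total weight
    factors over the coordinates into geometric series. *)
Lemma card_bounded_sum (R : realType) (J : finType) (L : nat) (x : R) :
  0 < x -> x < 1 ->
  #|[set f : {ffun J -> 'I_L.+1} | (\sum_j f j <= L)%N]%SET|%:R * x ^+ L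
    <= ((1 - x)^-1) ^+ #|J|.
Proof.
move=> x0 x1; set A := [set f | _]%SET.
have -> : #|A|%:R * x ^+ L = \sum_(f in A) x ^+ L by rewrite sumr_const mulr_natl.
apply: (@le_trans _ _ (\sum_(f : {ffun J -> 'I_L.+1}) \prod_j x ^+ f j)).
  rewrite [leRHS](bigID (mem A))/= -[leLHS]addr0 lerD//.
    apply: ler_sum => f; rewrite inE => fL.
    by rewrite prodrXr ler_wiXn2l// ltW.
  by apply: sumr_ge0 => f _; apply: prodr_ge0 => j _; rewrite exprn_ge0// ltW.
rewrite -(bigA_distr_bigA (fun _ (i : 'I_L.+1) => x ^+ i)).
rewrite prodr_const ?cardT -cardE.
have geo : \sum_(i < L.+1) x ^+ i <= (1 - x)^-1.
  have x10 : 0 < 1 - x by lra.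
  rewrite -(ler_pM2l x10) divff ?gt_eqF//.
  have := subrX1 x L.+1; move: (\sum_(i < L.+1) x ^+ i) => g hg.
  have : 0 <= x ^+ L.+1 by rewrite exprn_ge0// ltW.
  have : (1 - x) * g = 1 - x ^+ L.+1 by rewrite -[LHS]opprK -mulNr opprB -hg opprB.
  by move=> ->; lra.
rewrite lerXn2r ?nnegrE// ?invr_ge0; last by lra.
by apply: sumr_ge0 => i _; rewrite exprn_ge0// ltW.
Qed.

(** The weight x = k / (2 p) makes the 2 p geometric series contribute exp (2 k)
    only, so that the logarithm of the cardinal is of order k log (p / k). *)
Lemma card_net (R : realType) (p k q : nat) : (0 < k)%N -> (k <= p)%N ->
  #|@net R p k q|%:R
    <= expR (2 * k%:R + (q * k)%:R * ln (2 * p%:R / k%:R)) :> R.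
Proof.
move=> k0 kp; have p0 : (0 < p)%N by exact: leq_trans kp.
have kR : 0 < k%:R :> R by rewrite ltr0n.
have pR : 0 < p%:R :> R by rewrite ltr0n.
have kpR : k%:R <= p%:R :> R by rewrite ler_nat.
pose x : R := k%:R / (2 * p%:R).
have x0 : 0 < x by rewrite divr_gt0 ?mulr_gt0.
have x2 : x <= 2^-1 by rewrite /x ler_pdivrMr ?mulr_gt0//; lra.
have := @card_bounded_sum R ('I_p * bool)%type (q * k) x x0.
rewrite card_prod card_ord card_bool => /(_ _) h.
have {}h := h (le_lt_trans x2 _).
have xV : x^-1 = 2 * p%:R / k%:R by rewrite /x invf_div.
have -> : expR (2 * k%:R + (q * k)%:R * ln (2 * p%:R / k%:R)) =
    expR (2 * k%:R) / x ^+ (q * k).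
  rewrite expRD; congr (_ * _).
  by rewrite expRM_natl -xV lnK ?posrE ?invr_gt0// exprVn.
rewrite ler_pdivlMr ?exprn_gt0//.
apply: le_trans (le_trans (h _) _); last 2 first.
- by lra.
- have -> : expR (2 * k%:R) = expR (2 * x) ^+ (p * 2) :> R.
    rewrite -expRM_natr; congr expR; rewrite /x natrM; field.
    by rewrite gt_eqF.
  have e0 := expR_gt0 (2 * x).
  rewrite lerXn2r ?nnegrE ?(ltW e0) ?invr_ge0//; first by lra.
  rewrite -div1r ler_pdivrMr; last by lra.
  have : (1 + 2 * x) * (1 - x) <= expR (2 * x) * (1 - x).
    by apply: ler_wpM2r; [lra|exact: expR_ge1Dx].
  apply: le_trans; nra.
apply: ler_wpM2r; first by rewrite exprn_ge0// ltW.
rewrite ler_nat; apply: subset_leq_card; apply/fintype.subsetP => f.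
by rewrite !inE => /andP[].
Qed.

Section net_suffices.
Context {R : realType}.
Variables (p k : nat).
Hypotheses (k0 : (0 < k)%N) (kp : (k <= p)%N).

Lemma Theta0 : Theta p k (0 : 'cV[R]_p).
Proof.
apply: (supported_Theta (S := finset.set0)); first by rewrite cards0.
  by move=> j _; rewrite mxE.
by rewrite l2norm0.
Qed.

(** Absorption argument: the crude bound B0 makes the supremum finite, which
    allows half of it to be subtracted. *)
Lemma sup_halving (F : 'cV[R]_p -> R) (B0 N : R) :
  (forall theta, Theta p k theta -> F theta <= B0) ->
  (forall B, (forall theta, Theta p k theta -> F theta <= B) -> 0 <= B ->
     forall theta, Theta p k theta -> F theta <= N + B / 2) ->
  0 <= F 0 ->
  forall theta, Theta p k theta -> F theta <= 2 * N.
Proof.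
move=> FB0 halve F0 theta Ht.
pose A := [set F u | u in Theta p k].
have hA : has_sup A.
  split; first by exists (F 0), 0 => //; exact: Theta0.
  by exists B0 => _ [u Hu <-]; exact: FB0.
have supA u : Theta p k u -> F u <= sup A.
  by move=> Hu; apply: sup_upper_bound => //; exists u.
have sup0 : 0 <= sup A by rewrite (le_trans F0)// supA//; exact: Theta0.
have : sup A <= N + sup A / 2.
  by apply: ge_sup; [exact: hA.1|move=> _ [u Hu <-]; exact: halve].
by have := supA _ Ht; lra.
Qed.

(** The rounding error is k-sparse of norm at most 1 / 2: doubled, it belongs to
    Theta and is absorbed. *)
Lemma linear_net_bound (g : 'cV[R]_p) (N : R) :
  (forall f, f \in @net R p k 2 -> dotv (grid_point f) g <= N) ->
  forall theta, Theta p k theta -> dotv theta g <= 2 * N.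
Proof.
move=> hN; apply: (@sup_halving _ (l2norm g)).
- move=> theta [_ t1]; apply: (le_trans (dotv_le _ _)).
  by rewrite -[leRHS]mul1r ler_wpM2r ?l2norm_ge0.
- move=> B hB B0 theta Ht.
  have [f fnet [Sf fd]] := grid_approx k0 (isT : (0 < 2)%N) Ht.
  have -> : dotv theta g = dotv (grid_point f) g
      + dotv (2 *: (theta - grid_point f)) g / 2.
    by rewrite dotvZl dotvDl dotvNl; field.
  apply: lerD; first exact: hN.
  rewrite ler_pM2r ?invr_gt0//; apply: hB.
  apply: (supported_Theta (S := [set j | theta j 0 != 0]%SET)).
  + by rewrite card_supp; case: Ht.
  + apply: supportedZ; apply: supportedD; first exact: supported_supp.
    exact: supportedN.
  + by rewrite l2normZ ger0_norm//; lra.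
- by rewrite /dotv trmx0 mul0mx mxE.
Qed.

Lemma Theta_homogeneous (A : 'M[R]_p) (B : R) :
  (forall theta, Theta p k theta -> `|dotv theta (A *m theta)| <= B) ->
  forall (S : {set 'I_p}) u, (#|S| <= k)%N -> supported S u ->
  `|dotv u (A *m u)| <= B * l2norm u ^+ 2.
Proof.
move=> hB S u Sk Su.
have [u0|u0] := eqVneq (l2norm u) 0.
  by rewrite (l2norm_eq0 u0) /dotv trmx0 mul0mx mxE normr0 l2norm0 expr0n mulr0.
have up : 0 < l2norm u by rewrite lt_neqAle eq_sym u0 l2norm_ge0.
have Hv : Theta p k ((l2norm u)^-1 *: u).
  apply: (supported_Theta Sk); first exact: supportedZ.
  by rewrite l2normZ ger0_norm ?invr_ge0 ?l2norm_ge0// mulVf.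
have := hB _ Hv; rewrite dotvZl -scalemxAr dotvZr mulrA normrM.
rewrite ger0_norm -?expr2 ?sqr_ge0// exprVn mulrC ler_pdivrMr ?exprn_gt0//.
Qed.

(** Polarization within the coordinate subspace S, after u and v have been
    rescaled to equal norms. *)
Lemma bilinear_le (A : 'M[R]_p) (B : R) : A^T = A -> 0 <= B ->
  (forall theta, Theta p k theta -> `|dotv theta (A *m theta)| <= B) ->
  forall (S : {set 'I_p}) u v, (#|S| <= k)%N -> supported S u -> supported S v ->
  `|dotv u (A *m v)| <= B * (l2norm u * l2norm v).
Proof.
move=> symA B0 hB S.
have sym u v : dotv v (A *m u) = dotv u (A *m v).
  by rewrite dotvC /dotv trmx_mul symA mulmxA.
have polar u v : (#|S| <= k)%N -> supported S u -> supported S v ->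
    `|dotv u (A *m v)| <= B * (l2norm u ^+ 2 + l2norm v ^+ 2) / 2.
  move=> Sk Su Sv.
  have h1 := Theta_homogeneous hB Sk (supportedD Su Sv).
  have h2 := Theta_homogeneous hB Sk (supportedD Su (supportedN Sv)).
  rewrite sqr_l2norm mulmxDr !dotvDl !dotvDr -!sqr_l2norm in h1.
  rewrite sqr_l2norm mulmxDr mulmxN !dotvDl !dotvDr !dotvNl !dotvNr in h2.
  rewrite -!sqr_l2norm in h2.
  move: h1 h2; rewrite (sym u v) (dotvC v u) !ler_norml.
  by move=> /andP[h1 h2] /andP[h3 h4]; apply/andP; split; lra.
move=> u v Sk Su Sv.
have [u0|u0] := eqVneq (l2norm u) 0.
  by rewrite (l2norm_eq0 u0) /dotv trmx0 mul0mx mxE normr0 l2norm0 mul0r mulr0.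
have [v0|v0] := eqVneq (l2norm v) 0.
  by rewrite (l2norm_eq0 v0) mulmx0 /dotv mulmx0 mxE normr0 l2norm0 !mulr0.
have up : 0 < l2norm u by rewrite lt_neqAle eq_sym u0 l2norm_ge0.
have vp : 0 < l2norm v by rewrite lt_neqAle eq_sym v0 l2norm_ge0.
have := polar _ _ Sk (supportedZ (l2norm v) Su) (supportedZ (l2norm u) Sv).
rewrite !l2normZ dotvZl -scalemxAr dotvZr !normrM.
rewrite !(ger0_norm (l2norm_ge0 _)) => h.
have uv : 0 < l2norm v * l2norm u by rewrite mulr_gt0.
rewrite -(ler_pM2l uv) -mulrA (le_trans h)// le_eqVlt; apply/orP; left; apply/eqP.
by field.
Qed.

(** For f the rounding of theta, the two values of the form differ by
    (theta - f)^T A (theta + f). The second factor has norm at most 2, hence the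
    finer mesh 1 / 4, which again leaves half of the supremum. *)
Lemma quadratic_net_bound (A : 'M[R]_p) (N : R) : A^T = A ->
  (forall f, f \in @net R p k 4 ->
     `|dotv (grid_point f) (A *m grid_point f)| <= N) ->
  forall theta, Theta p k theta -> `|dotv theta (A *m theta)| <= 2 * N.
Proof.
move=> symA hN.
apply: (@sup_halving (fun u => `|dotv u (A *m u)|) (\sum_i \sum_j `|A i j|)).
- move=> theta [_ t1].
  have tj j : `|theta j 0| <= 1 by exact: le_trans (abs_coord_le theta j) t1.
  rewrite dotvE (le_trans (ler_norm_sum _ _ _))// ler_sum// => i _.
  rewrite normrM -[leRHS]mul1r ler_pM// mxE (le_trans (ler_norm_sum _ _ _))//.
  by rewrite ler_sum// => j _; rewrite normrM -[leRHS]mulr1 ler_wpM2l.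
- move=> B hB B0 theta Ht.
  have [f fnet [Sf fd]] := grid_approx k0 (isT : (0 < 4)%N) Ht.
  set S := [set j | theta j 0 != 0]%SET.
  have Sk : (#|S| <= k)%N by rewrite card_supp; case: Ht.
  have St : supported S theta by exact: supported_supp.
  have Th1 := Ht.2.
  have gt1 : l2norm (grid_point f : 'cV[R]_p) <= 1.
    by move: fnet; rewrite inE => /andP[_ /asboolP[]].
  have E : dotv theta (A *m theta) = dotv (grid_point f) (A *m grid_point f)
      + dotv (theta - grid_point f) (A *m (theta + grid_point f)).
    rewrite mulmxDr !dotvDl !dotvDr !dotvNl.
    have -> : dotv theta (A *m grid_point f) = dotv (grid_point f) (A *m theta).
      by rewrite dotvC /dotv trmx_mul symA mulmxA.
    ring.
  rewrite E (le_trans (ler_normD _ _))// lerD ?hN//.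
  have Sd : supported S (theta - grid_point f).
    by apply: supportedD => //; exact: supportedN.
  have Ss : supported S (theta + grid_point f) by exact: supportedD.
  apply: (le_trans (bilinear_le symA B0 hB Sk Sd Ss)).
  rewrite ler_wpM2l//.
  have hs : l2norm (theta + grid_point f) <= 2.
    by rewrite (le_trans (l2norm_triangle _ _))//; have := lerD Th1 gt1; lra.
  apply: (le_trans (ler_pM (l2norm_ge0 _) (l2norm_ge0 _) fd hs)); lra.
- exact: normr_ge0.
Qed.

End net_suffices.

(** * Submodels and the operator norm *)

Section submodels.
Context {R : realType}.
Variables (p : nat) (M : {set 'I_p}).

(** Its transpose embeds R^M into R^p isometrically, onto the vectors supported
    in M; this transfers bounds over sparse vectors to submodels. *)
Definition model_proj : 'M[R]_(#|M|, p) := rowsub (@enum_val _ (mem M)) 1%:M.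

Lemma subvecE (v : 'cV[R]_p) : subvec M v = model_proj *m v.
Proof. by rewrite /model_proj mul_rowsub_mx mul1mx. Qed.

Lemma submatE (A : 'M[R]_p) : submat M A = model_proj *m A *m model_proj^T.
Proof.
rewrite /model_proj mul_rowsub_mx mul1mx.
apply/matrixP => i j; rewrite !mxE (bigD1 (enum_val j))//= !mxE eqxx mulr1.
rewrite big1 ?addr0// => l lj; rewrite !mxE eq_sym (negbTE lj) mulr0//.
Qed.

Lemma model_projK : model_proj *m model_proj^T = 1%:M.
Proof.
rewrite /model_proj mul_rowsub_mx mul1mx.
by apply/matrixP => i j; rewrite !mxE (inj_eq enum_val_inj) eq_sym.
Qed.

Lemma dotv_model_proj (u : 'cV[R]_#|M|) (v : 'cV[R]_p) :
  dotv (model_proj^T *m u) v = dotv u (model_proj *m v).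
Proof. by rewrite /dotv trmx_mul trmxK mulmxA. Qed.

Lemma l2norm_model_proj (u : 'cV[R]_#|M|) : l2norm (model_proj^T *m u) = l2norm u.
Proof.
apply/eqP; rewrite -(@eqrXn2 _ 2)// ?l2norm_ge0//; apply/eqP.
by rewrite !sqr_l2norm dotv_model_proj mulmxA model_projK mul1mx.
Qed.

Lemma supported_model_proj (u : 'cV[R]_#|M|) : supported M (model_proj^T *m u).
Proof.
move=> j jM; rewrite mxE big1// => i _; rewrite !mxE.
have [e|] := eqVneq (enum_val i) j; last by rewrite mul0r.
by move: jM; rewrite -e enum_valP.
Qed.

Lemma subvec_le k (g : 'cV[R]_p) (B : R) : (#|M| <= k)%N ->
  (forall theta, Theta p k theta -> dotv theta g <= B) ->
  l2norm (subvec M g) <= B.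
Proof.
move=> Mk hB; set v := subvec M g.
have [v0|v0] := eqVneq (l2norm v) 0.
  rewrite v0; have := hB 0 (Theta0 _ _).
  by rewrite /dotv trmx0 mul0mx mxE.
have vp : 0 < l2norm v by rewrite lt_neqAle eq_sym v0 l2norm_ge0.
have := hB ((l2norm v)^-1 *: (model_proj^T *m v)) _.
rewrite dotvZl dotv_model_proj -subvecE -/v -sqr_l2norm expr2 mulKf//; apply.
apply: (supported_Theta Mk); first exact/supportedZ/supported_model_proj.
by rewrite l2normZ l2norm_model_proj ger0_norm ?invr_ge0 ?l2norm_ge0// mulVf.
Qed.

Lemma submat_le k (A : 'M[R]_p) (B : R) : (#|M| <= k)%N -> A^T = A ->
  (forall theta, Theta p k theta -> `|dotv theta (A *m theta)| <= B) ->
  forall u, l2norm (submat M A *m u) <= B * l2norm u.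
Proof.
move=> Mk symA hB u.
have B0 : 0 <= B by apply: le_trans (hB 0 (Theta0 _ _)).
set w := submat M A *m u.
have [w0|w0] := eqVneq (l2norm w) 0.
  by rewrite w0 mulr_ge0 ?l2norm_ge0.
have wp : 0 < l2norm w by rewrite lt_neqAle eq_sym w0 l2norm_ge0.
have := bilinear_le symA B0 hB Mk (supported_model_proj w) (supported_model_proj u).
rewrite dotv_model_proj !l2norm_model_proj !mulmxA -submatE -/w -sqr_l2norm.
rewrite ger0_norm ?sqr_ge0// => h.
by rewrite -(ler_pM2l wp) -expr2 (le_trans h)// mulrCA.
Qed.

End submodels.

Section operator_norm.
Context {R : realType}.
Variables (m : nat).
Implicit Types (A : 'M[R]_m) (u : 'cV[R]_m).

Lemma opnorm_leP A (B : R) : 0 <= B ->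
  opnorm A <= B <-> (forall u, l2norm (A *m u) <= B * l2norm u).
Proof.
move=> B0; split => [hB u|hB].
  have [u0|u0] := eqVneq (l2norm u) 0.
    by rewrite (l2norm_eq0 u0) mulmx0 !l2norm0 mulr0.
  have up : 0 < l2norm u by rewrite lt_neqAle eq_sym u0 l2norm_ge0.
  have h : l2norm (A *m ((l2norm u)^-1 *: u)) <= B.
    apply: le_trans hB; apply: sup_upper_bound.
      split; first by exists (l2norm (A *m 0)), 0 => //=; rewrite l2norm0.
      exists ((\sum_i \sum_j `|A i j|) * 1) => _ [x /= x1 <-].
      apply: (le_trans (l2norm_mulmx_le _ _)); apply: ler_wpM2l => //.
      by apply: sumr_ge0 => i _; apply: sumr_ge0.
    exists ((l2norm u)^-1 *: u) => //=.
    by rewrite l2normZ ger0_norm ?invr_ge0 ?l2norm_ge0// mulVf.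
  move: h; rewrite -scalemxAr l2normZ ger0_norm ?invr_ge0 ?l2norm_ge0//.
  by rewrite mulrC ler_pdivrMr.
apply: ge_sup; first by exists (l2norm (A *m 0)), 0 => //=; rewrite l2norm0.
move=> _ [u /= u1 <-]; rewrite (le_trans (hB u))//.
by rewrite -[leRHS]mulr1 ler_wpM2l.
Qed.

(** Rational vectors are dense and both sides are Lipschitz in the vector. *)
Lemma opnorm_le_rat A (B : R) : 0 <= B ->
  (forall r : 'cV[rat]_m, l2norm (A *m map_mx ratr r) <= B * l2norm (map_mx ratr r)) ->
  opnorm A <= B.
Proof.
move=> B0 hB; apply/(opnorm_leP _ B0) => u.
set C := \sum_i \sum_j `|A i j|.
have C0 : 0 <= C by apply: sumr_ge0 => i _; apply: sumr_ge0.
apply/ler_addgt0Pr => e e0.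
pose eta := e / (B + C + 1) / (m%:R + 1).
have bc : 0 < B + C + 1 by lra.
have m1 : 0 < m%:R + 1 :> R by rewrite ltr_wpDl.
have eta0 : 0 < eta by rewrite !divr_gt0.
have /choice[r hr] : forall j, exists x : rat, `|u j 0 - ratr x| <= eta.
  move=> j; have := @rat_in_itvoo R (u j 0 - eta) (u j 0 + eta).
  case; first lra.
  by move=> x; rewrite in_itv/= => /andP[x1 x2]; exists x; rewrite ler_norml; lra.
pose v : 'cV[R]_m := map_mx ratr (\col_j r j).
have duv : l2norm (u - v) <= e / (B + C + 1).
  apply: (le_trans (l2norm_le_l1 _)).
  apply: (@le_trans _ _ (\sum_(j < m) eta)).
    by apply: ler_sum => j _; rewrite !mxE.
  rewrite sumr_const card_ord -mulr_natl /eta mulrCA -[leRHS]mulr1 ler_wpM2l//.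
    by rewrite ltW// divr_gt0.
  by rewrite ler_pdivrMr// mul1r; lra.
have hv : l2norm v <= l2norm u + l2norm (u - v).
  have := l2norm_triangle u (- 1 *: (u - v)).
  by rewrite l2normZ normrN normr1 mul1r scaleN1r opprB addrCA subrr addr0.
have -> : A *m u = A *m v + A *m (u - v) by rewrite -mulmxDr addrCA subrr addr0.
apply: (le_trans (l2norm_triangle _ _)).
have h1 := hB (\col_j r j); rewrite -/v in h1.
have h2 := l2norm_mulmx_le A (u - v); rewrite -/C in h2.
have h3 := ler_wpM2l B0 hv.
have h4 : (B + C + 1) * l2norm (u - v) <= e by rewrite mulrC -ler_pdivlMr.
have := l2norm_ge0 (u - v); nra.
Qed.

End operator_norm.

(** * The statistics and their events *)

Section finite_sums.
Context {R : realType} {d : measure_display} {T : measurableType d}.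
Variable P : probability T R.

Lemma Rintegrable_sum (I : Type) (r : seq I) (f : I -> T -> R) :
  (forall i, P.-integrable setT (EFin \o f i)) ->
  P.-integrable setT (EFin \o (fun w => \sum_(i <- r) f i w)).
Proof.
move=> fi; elim: r => [|i r IH].
  rewrite (_ : EFin \o _ = EFin \o (fun=> 0)); first exact: prob_integrable_cst.
  by apply/funext => w /=; rewrite big_nil.
rewrite (_ : EFin \o _ = EFin \o (fun w => f i w + \sum_(j <- r) f j w)).
  exact: Rintegrable_add.
by apply/funext => w /=; rewrite big_cons.
Qed.

Lemma Rintegral_sum (I : Type) (r : seq I) (f : I -> T -> R) :
  (forall i, P.-integrable setT (EFin \o f i)) ->
  \int[P]_w (\sum_(i <- r) f i w) = \sum_(i <- r) \int[P]_w f i w.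
Proof.
move=> fi; elim: r => [|i r IH].
  by under eq_Rintegral do rewrite big_nil; rewrite big_nil prob_Rintegral_cst.
under eq_Rintegral do rewrite big_cons.
by rewrite RintegralD// ?IH ?big_cons//; exact: Rintegrable_sum.
Qed.

Lemma fine_expectation (X : T -> R) : fine ('E_P[X])%E = \int[P]_w X w.
Proof. by rewrite unlock. Qed.

(** The covering set is existential so that membership need not be traced
    through an iterated union. *)
Lemma union_bound (I : eqType) (r : seq I) (E : I -> set T) (e : R) :
  (forall i, measurable (E i)) -> {in r, forall i, (P (E i) <= e%:E)%E} ->
  exists U, [/\ measurable U, (P U <= ((size r)%:R * e)%:E)%E &
    {in r, forall i, E i `<=` U}].
Proof.
move=> mE; elim: r => [|i r IH] hE.
  by exists set0; split => //; rewrite measure0 mul0r.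
have [|U [mU PU hU]] := IH; first by move=> j jr; apply: hE; rewrite inE jr orbT.
exists (E i `|` U); split.
- exact: measurableU.
- apply: (le_trans (measureU2 P (mE i) mU)).
  rewrite /= -natr1 mulrDl mul1r addrC EFinD leeD// hE// inE eqxx//.
- move=> j; rewrite inE => /orP[/eqP ->|jr]; first by move=> w; left.
  by move=> w wE; right; exact: (hU j jr).
Qed.

End finite_sums.

Lemma sup_models_leP (R : realType) (p k : nat) (F : {set 'I_p} -> R) (B : R) :
  (0 < k)%N -> (k <= p)%N ->
  sup [set F M | M in models p k] <= B <-> (forall M, models p k M -> F M <= B).
Proof.
move=> k0 kp; have p0 : (0 < p)%N by exact: leq_trans kp.
have ne : [set F M | M in models p k] !=set0.
  pose M0 : {set 'I_p} := finset.set1 (Ordinal p0).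
  by exists (F M0), M0 => //; rewrite /models/= finset.cards1.
split => [h M HM|h]; last by apply: ge_sup => // _ [M HM <-]; exact: h.
apply: le_trans h; apply: sup_upper_bound; last by exists M.
split => //; exists (\sum_M `|F M|) => _ [M' _ <-].
by rewrite (bigD1 M')//= (le_trans (ler_norm _))// lerDl sumr_ge0.
Qed.

Lemma sub_mxE (V : zmodType) m n (A B : 'M[V]_(m, n)) i j :
  (A - B) i j = A i j - B i j.
Proof. by rewrite !mxE. Qed.

Lemma mulmx_colE (R : realType) m (A : 'M[R]_m) (u : 'cV[R]_m) i :
  (A *m u) i 0 = \sum_j A i j * u j 0.
Proof. by rewrite mxE. Qed.

Section sample_statistics.
Context {R : realType} {d : measure_display} {T : measurableType d}.
Variables (P : probability T R) (n p k : nat).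
Variables (X : 'I_n -> {RV P >-> p.-tuple R}) (Y : 'I_n -> {RV P >-> R}).
Hypotheses (k0 : (0 < k)%N) (kp : (k <= p)%N).

Lemma measurable_coord i j : measurable_fun setT (fun w => vec X i w j 0).
Proof.
under eq_fun do rewrite mxE.
exact: (measurableT_comp (measurable_tnth j) (measurable_funP (X i))).
Qed.

Lemma measurable_response i : measurable_fun setT (Y i : T -> R).
Proof. exact: measurable_funP. Qed.

Lemma Gamma_hatE w a : Gamma_hat X Y w a 0 =
  n%:R^-1 * \sum_(i < n) (vec X i w a 0 * Y i w).
Proof.
rewrite mxE summxE; congr (_ * _); apply: eq_bigr => i _.
by rewrite mxE mulrC.
Qed.

Lemma Sigma_hatE w a b : Sigma_hat X w a b =
  n%:R^-1 * \sum_(i < n) (vec X i w a 0 * vec X i w b 0).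
Proof.
rewrite mxE summxE; congr (_ * _); apply: eq_bigr => i _.
by rewrite mxE big_ord1 !mxE.
Qed.

Lemma measurable_Gamma_hat a : measurable_fun setT (fun w => Gamma_hat X Y w a 0).
Proof.
under eq_fun do rewrite Gamma_hatE.
apply: measurable_funM; first exact: measurable_cst.
apply: measurable_fun_bigsum => i; apply: measurable_funM.
  exact: measurable_coord.
exact: measurable_response.
Qed.

Lemma measurable_Sigma_hat a b : measurable_fun setT (fun w => Sigma_hat X w a b).
Proof.
under eq_fun do rewrite Sigma_hatE.
apply: measurable_funM; first exact: measurable_cst.
by apply: measurable_fun_bigsum => i; apply: measurable_funM; exact: measurable_coord.
Qed.

Lemma measurable_l2norm_le m (v : T -> 'cV[R]_m) (c : R) : 0 <= c ->
  (forall j, measurable_fun setT (fun w => v w j 0)) ->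
  measurable [set w | l2norm (v w) <= c].
Proof.
move=> c0 mv.
rewrite (_ : [set w | _] = [set w | \sum_j v w j 0 ^+ 2 <= c ^+ 2]).
  by apply: measurable_sublevel; apply: measurable_fun_bigsum => j; exact: measurable_funX.
apply/seteqP; split => w /=.
  rewrite -(@ler_pXn2r _ 2)// ?nnegrE ?l2norm_ge0// sqr_sqrtr//.
  by apply: sumr_ge0 => j _; exact: sqr_ge0.
move=> h; rewrite -(@ler_pXn2r _ 2)// ?nnegrE ?l2norm_ge0// sqr_sqrtr//.
by apply: sumr_ge0 => j _; exact: sqr_ge0.
Qed.

Lemma measurable_models_le (F : {set 'I_p} -> T -> R) (B : R) :
  (forall M, measurable [set w | F M w <= B]) ->
  measurable [set w | sup [set F M w | M in models p k] <= B].
Proof.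
move=> mF.
rewrite (_ : [set w | _] = \bigcap_(M in models p k) [set w | F M w <= B]).
  exact: fin_bigcap_measurable.
by apply/seteqP; split => w /= /(sup_models_leP (F ^~ w) B k0 kp).
Qed.

Lemma measurable_DD_le (B : R) : 0 <= B -> measurable [set w | DD X Y k w <= B].
Proof.
move=> B0; apply: measurable_models_le => M.
apply: measurable_l2norm_le => // j.
rewrite (_ : (fun w => _) =
    fun w => Gamma_hat X Y w (enum_val j) 0 - Gamma X Y (enum_val j) 0); last first.
  apply/funext => w; rewrite [LHS]mxE; congr (_ + _); first exact: mxE.
  by rewrite [LHS]mxE; congr (- _); exact: mxE.
apply: measurable_funB; last exact: measurable_cst.
exact: measurable_Gamma_hat.
Qed.

(** The operator norm is a supremum over an uncountable ball, but testing it on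
    rational vectors makes the event a countable intersection. *)
Lemma measurable_RIP_le (B : R) : 0 <= B -> measurable [set w | RIP X k w <= B].
Proof.
move=> B0; apply: measurable_models_le => M.
pose A w : 'M[R]_#|M| := submat M (Sigma_hat X w) - submat M (Sigma X).
pose Q (r : 'cV[rat]_#|M|) : set T :=
  [set w | l2norm (A w *m map_mx ratr r) <= B * l2norm (map_mx ratr r : 'cV[R]_#|M|)].
have mQ r : measurable (Q r).
  apply: measurable_l2norm_le; first by rewrite mulr_ge0 ?l2norm_ge0.
  move=> j; under eq_fun do rewrite mxE.
  apply: measurable_fun_bigsum => i; apply: measurable_funM; last exact: measurable_cst.
  rewrite (_ : (fun w => _) = fun w => Sigma_hat X w (enum_val j) (enum_val i)
      - Sigma X (enum_val j) (enum_val i)); last first.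
    apply/funext => w; rewrite [LHS]mxE; congr (_ + _); first exact: mxE.
    by rewrite [LHS]mxE; congr (- _); exact: mxE.
  apply: measurable_funB; last exact: measurable_cst.
  exact: measurable_Sigma_hat.
rewrite (_ : [set w | _] =
    \bigcap_(m : nat) (if unpickle m is Some r then Q r else setT)).
  by apply: bigcap_measurable => // m _; case: unpickle.
apply/seteqP; split => w /=.
  by move/(opnorm_leP _ B0) => h m _; case: unpickle => // r; exact: h.
move=> h; apply: opnorm_le_rat => // r.
by have := h (pickle r) Logic.I; rewrite pickleK.
Qed.

Lemma dotv_Gamma_dev (theta : 'cV[R]_p) w :
  (forall i a, P.-integrable setT (EFin \o (fun w => vec X i w a 0 * Y i w))) ->
  dotv theta (Gamma_hat X Y w - Gamma X Y) = n%:R^-1 *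
    \sum_(i < n) (dotv theta (vec X i w) * Y i w
      - fine ('E_P[fun w => (dotv theta (vec X i w) * Y i w)%R])%E).
Proof.
move=> int.
have GE a : Gamma X Y a 0 = n%:R^-1 * \sum_(i < n) \int[P]_w (vec X i w a 0 * Y i w).
  rewrite mxE fine_expectation; under eq_Rintegral do rewrite Gamma_hatE.
  rewrite RintegralZl//; last exact: Rintegrable_sum.
  by rewrite Rintegral_sum.
rewrite dotvE.
transitivity (n%:R^-1 * \sum_(i < n) \sum_a
    (theta a 0 * (vec X i w a 0 * Y i w) - theta a 0 * \int[P]_w (vec X i w a 0 * Y i w))).
  rewrite exchange_big/= mulr_sumr; apply: eq_bigr => a _.
  rewrite sub_mxE GE Gamma_hatE sumrB -!mulr_sumr; ring.
congr (_ * _); apply: eq_bigr => i _.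
rewrite sumrB fine_expectation; congr (_ - _).
  by rewrite dotvE mulr_suml; apply: eq_bigr => a _; rewrite mulrA.
transitivity (\int[P]_w \sum_a theta a 0 * (vec X i w a 0 * Y i w)).
  rewrite Rintegral_sum; last by move=> a; exact: Rintegrable_scale.
  by apply: eq_bigr => a _; rewrite RintegralZl.
apply: eq_Rintegral => z _; rewrite dotvE mulr_suml; apply: eq_bigr => a _.
by rewrite mulrA.
Qed.

Lemma dotv_Sigma_dev (theta : 'cV[R]_p) w :
  (forall i a b, P.-integrable setT
     (EFin \o (fun w => vec X i w a 0 * vec X i w b 0))) ->
  dotv theta ((Sigma_hat X w - Sigma X) *m theta) = n%:R^-1 *
    \sum_(i < n) (dotv theta (vec X i w) ^+ 2
      - fine ('E_P[fun w => (dotv theta (vec X i w) ^+ 2)%R])%E).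
Proof.
move=> int.
have SE a b : Sigma X a b =
    n%:R^-1 * \sum_(i < n) \int[P]_w (vec X i w a 0 * vec X i w b 0).
  rewrite mxE fine_expectation; under eq_Rintegral do rewrite Sigma_hatE.
  rewrite RintegralZl//; last exact: Rintegrable_sum.
  by rewrite Rintegral_sum.
have sqE i z : dotv theta (vec X i z) ^+ 2 =
    \sum_a \sum_b theta a 0 * theta b 0 * (vec X i z a 0 * vec X i z b 0).
  rewrite dotvE expr2 mulr_suml; apply: eq_bigr => a _.
  by rewrite mulr_sumr; apply: eq_bigr => b _; ring.
transitivity (n%:R^-1 * \sum_(i < n) \sum_a \sum_b theta a 0 * theta b 0 *
    (vec X i w a 0 * vec X i w b 0 - \int[P]_w (vec X i w a 0 * vec X i w b 0))).
  rewrite dotvE exchange_big/= mulr_sumr; apply: eq_bigr => a _.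
  rewrite mulmx_colE exchange_big/= mulr_sumr mulr_sumr; apply: eq_bigr => b _.
  rewrite sub_mxE SE Sigma_hatE -mulr_sumr sumrB; ring.
congr (_ * _); apply: eq_bigr => i _.
rewrite fine_expectation sqE.
under eq_Rintegral do rewrite sqE.
rewrite Rintegral_sum; last first.
  by move=> a; apply: Rintegrable_sum => b; exact: Rintegrable_scale.
rewrite -sumrB; apply: eq_bigr => a _.
rewrite Rintegral_sum; last by move=> b; exact: Rintegrable_scale.
rewrite -sumrB; apply: eq_bigr => b _.
by rewrite RintegralZl// mulrBr.
Qed.

Lemma Sigma_dev_sym w : (Sigma_hat X w - Sigma X)^T = Sigma_hat X w - Sigma X.
Proof.
have hatC z a b : Sigma_hat X z b a = Sigma_hat X z a b.
  by rewrite !Sigma_hatE; congr (_ * _); apply: eq_bigr => i _; rewrite mulrC.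
apply/matrixP => a b; rewrite mxE [LHS]mxE [RHS]mxE hatC; congr (_ + _).
rewrite [LHS]mxE [RHS]mxE; congr (- _); rewrite [LHS]mxE [RHS]mxE.
by congr fine; congr expectation; apply/funext => z; exact: hatC.
Qed.

Lemma DD_le (w : T) (N : R) :
  (forall f, f \in @net R p k 2 ->
     dotv (grid_point f) (Gamma_hat X Y w - Gamma X Y) <= N) ->
  DD X Y k w <= 2 * N.
Proof.
move=> hN; apply/(sup_models_leP _ _ k0 kp) => M /andP[_ Mk].
rewrite !subvecE -mulmxBr -subvecE.
by apply: (subvec_le Mk); exact: linear_net_bound.
Qed.

Lemma RIP_le (w : T) (N : R) :
  (forall f, f \in @net R p k 4 ->
     `|dotv (grid_point f) ((Sigma_hat X w - Sigma X) *m grid_point f)| <= N) ->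
  RIP X k w <= 2 * N.
Proof.
move=> hN; apply/(sup_models_leP _ _ k0 kp) => M /andP[_ Mk].
have hQ := quadratic_net_bound k0 (Sigma_dev_sym w) hN.
have B0 : 0 <= 2 * N by apply: le_trans (hQ 0 (Theta0 _ _)).
have -> : submat M (Sigma_hat X w) - submat M (Sigma X) =
    submat M (Sigma_hat X w - Sigma X).
  by rewrite !submatE mulmxBr mulmxBl.
by apply/(opnorm_leP _ B0); apply: (submat_le Mk) => //; exact: Sigma_dev_sym.
Qed.

End sample_statistics.

(** * Orlicz moments *)

Section orlicz_moments.
Context {R : realType} {d : measure_display} {T : measurableType d}.
Variable P : probability T R.
Implicit Types V W : T -> R.

(** For D = 2 this is the condition that defines the Orlicz norm; larger D leave
    room for crude bounds on maxima. *)
Definition orlicz_moment_le (beta L D : R) W : Prop :=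
  (\int[P]_w (expR ((`|W w| / L) `^ beta))%:E <= D%:E)%E.

Lemma measurable_orlicz (beta L : R) W : measurable_fun setT W ->
  measurable_fun setT (fun w => expR ((`|W w| / L) `^ beta)).
Proof.
move=> mW; apply: measurableT_comp => //; apply: measurable_fun_powR.
apply: measurable_funM; last exact: measurable_cst.
exact: measurableT_comp.
Qed.

(** The infimum that defines the norm need not be attained, hence the strictly
    larger scale c. *)
Lemma psi_norm_moment (alpha K c : R) W : 0 < alpha -> K < c ->
  measurable_fun setT W -> (psi_norm P alpha W <= K%:E)%E ->
  orlicz_moment_le alpha c 2 W.
Proof.
move=> alpha0 Kc mW hW.
have : (psi_norm P alpha W < c%:E)%E by rewrite (le_lt_trans hW) ?lte_fin.
rewrite /psi_norm => /ereal_inf_lt[_ [C [C0 hC] <-]]; rewrite lte_fin => Cc.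
have c0 : 0 < c by exact: lt_trans Cc.
rewrite unlock in hC; apply: le_trans hC.
apply: integral_EFin_le; first exact: measurable_orlicz.
- apply: measurableT_comp => //; apply: measurable_funM; last exact: measurable_cst.
  by apply: measurable_fun_powR; exact: measurableT_comp.
- by move=> w; exact: expR_ge0.
- move=> w; rewrite ler_expR ler_pdivlMr ?powR_gt0// -powRM ?divr_ge0 ?(ltW c0) ?(ltW C0)//.
  rewrite ge0_ler_powR ?nnegrE ?(ltW alpha0)//.
    by rewrite mulr_ge0 ?divr_ge0 ?(ltW c0) ?(ltW C0).
  by rewrite mulrAC ler_pdivrMr// ler_wpM2l// ltW.
Qed.

Lemma orlicz_momentW (beta L D D' : R) W : D <= D' ->
  orlicz_moment_le beta L D W -> orlicz_moment_le beta L D' W.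
Proof. by move=> DD' h; apply: (le_trans h); rewrite lee_fin. Qed.

Lemma integral_mean_le V W (a b : R) :
  measurable_fun setT V -> measurable_fun setT W ->
  (forall w, 0 <= V w) -> (forall w, 0 <= W w) ->
  (\int[P]_w (V w)%:E <= a%:E)%E -> (\int[P]_w (W w)%:E <= b%:E)%E ->
  (\int[P]_w (2^-1 * (V w + W w))%:E <= ((a + b) / 2)%:E)%E.
Proof.
move=> mV mW V0 W0 /(Rintegrable_of_le mV V0)[iV EV].
move=> /(Rintegrable_of_le mW W0)[iW EW].
have iS := Rintegrable_add iV iW.
rewrite (Rintegral_EFin (Rintegrable_scale 2^-1 iS)) RintegralZl//.
by rewrite (RintegralD _ iV iW)// lee_fin; lra.
Qed.

(** Young's inequality in the exponent, followed by the convexity of exp. *)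
Lemma orlicz_moment_mul (alpha c1 c2 D1 D2 : R) V W : 0 < c1 -> 0 < c2 ->
  measurable_fun setT V -> measurable_fun setT W ->
  orlicz_moment_le alpha c1 D1 V -> orlicz_moment_le alpha c2 D2 W ->
  orlicz_moment_le (alpha / 2) (c1 * c2) ((D1 + D2) / 2) (fun w => V w * W w).
Proof.
move=> c10 c20 mV mW hV hW.
have mMV := measurable_orlicz alpha c1 mV.
have mMW := measurable_orlicz alpha c2 mW.
have hM := integral_mean_le mMV mMW (fun w => expR_ge0 _) (fun w => expR_ge0 _) hV hW.
apply: le_trans hM.
apply: integral_EFin_le.
- by apply: measurable_orlicz; exact: measurable_funM.
- exact: (measurable_funM (measurable_cst _) (measurable_funD mMV mMW)).
- by move=> w; exact: expR_ge0.
move=> w; set a := `|V w| / c1; set b := `|W w| / c2.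
have a0 : 0 <= a by rewrite divr_ge0// ltW.
have b0 : 0 <= b by rewrite divr_ge0// ltW.
have -> : `|V w * W w| / (c1 * c2) = a * b.
  by rewrite normrM /a /b; field; rewrite !gt_eqF.
have sq x : 0 <= x -> x `^ alpha = (x `^ (alpha / 2)) ^+ 2.
  move=> x0; rewrite -powR_mulrn ?powR_ge0// -powRrM; congr (_ `^ _); by field.
rewrite powRM// !sq//; set x := a `^ _; set y := b `^ _.
have h1 : expR (x * y) <= expR ((x ^+ 2) / 2) * expR ((y ^+ 2) / 2).
  by rewrite -expRD ler_expR; have := sqr_ge0 (x - y); nra.
have h2 (z : R) : expR z = expR (z / 2) ^+ 2.
  by rewrite -expRM_natr; congr expR; field.
rewrite (h2 (x ^+ 2)) (h2 (y ^+ 2)); apply: (le_trans h1).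
move: (expR (x ^+ 2 / 2)) (expR (y ^+ 2 / 2)) => e f.
by have := sqr_ge0 (e - f); nra.
Qed.

Lemma orlicz_integrable (beta L D : R) W : 0 < beta -> 0 < L ->
  measurable_fun setT W -> orlicz_moment_le beta L D W ->
  P.-integrable setT (EFin \o W).
Proof.
move=> b0 L0 mW hW.
have [iM _] := Rintegrable_of_le (measurable_orlicz beta L mW) (fun w => expR_ge0 _) hW.
apply: Rintegrable_le (Rintegrable_scale (L * (2 / beta) `^ (1 / beta)) iM) => //.
by move=> w; exact: abs_le_orlicz.
Qed.

Lemma orlicz_variance_le (beta L D : R) W : 0 < beta -> 0 < L ->
  measurable_fun setT W -> orlicz_moment_le beta L D W ->
  ('V_P[W] <= (2 * ((L * (4 / beta) `^ (1 / beta)) ^+ 2 * D)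
     + 2 * (L * (2 / beta) `^ (1 / beta) * D) ^+ 2)%:E)%E.
Proof.
move=> b0 L0 mW hW.
have mM := measurable_orlicz beta L mW.
have [iM EM] := Rintegrable_of_le mM (fun w => expR_ge0 _) hW.
set m := fine ('E_P[W])%E.
set A := (L * (4 / beta) `^ (1 / beta)) ^+ 2; set B := L * (2 / beta) `^ (1 / beta).
have A0 : 0 <= A by exact: sqr_ge0.
have B0 : 0 <= B by rewrite mulr_ge0 ?powR_ge0// ltW.
have iW := orlicz_integrable b0 L0 mW hW.
have hm : m ^+ 2 <= (B * D) ^+ 2.
  rewrite -[leLHS]real_normK ?num_real// lerXn2r ?nnegrE//.
    rewrite mulr_ge0// (le_trans _ EM)//; apply: Rintegral_ge0 => w _.
    exact: expR_ge0.
  rewrite /m fine_expectation (le_trans (le_normr_Rintegral _ iW))//.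
  apply: (@le_trans _ _ (\int[P]_w (B * expR ((`|W w| / L) `^ beta)))).
    apply: Rintegral_le; first exact: integrable_norm.
      exact: Rintegrable_scale.
    by move=> w; exact: abs_le_orlicz.
  by rewrite RintegralZl// ler_wpM2l.
rewrite variance_integral -/m.
apply: (@le_trans _ _ (\int[P]_w
   (2 * A * expR ((`|W w| / L) `^ beta) + 2 * m ^+ 2)%:E)%E).
  apply: integral_EFin_le.
  - apply: measurable_funX; apply: measurable_funB => //; exact: measurable_cst.
  - apply: measurable_funD; last exact: measurable_cst.
    by apply: measurable_funM => //; exact: measurable_cst.
  - by move=> w; rewrite sqr_ge0.
  - move=> w /=; have := sqr_le_orlicz b0 L0 (W w); rewrite -/A.
    by have := sqr_ge0 (W w + m); nra.
rewrite Rintegral_EFin; last first.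
  by apply: Rintegrable_add; [exact: Rintegrable_scale|exact: prob_integrable_cst].
rewrite RintegralD//; last 2 first.
- exact: Rintegrable_scale.
- exact: prob_integrable_cst.
rewrite RintegralZl// prob_Rintegral_cst lee_fin.
have := ler_wpM2l A0 EM; lra.
Qed.

(** A k-sparse combination is at most sqrt k times the largest coordinate in its
    support. Bounding the maximum by the sum over the support costs a factor k
    in the moment, which the concentration inequality tolerates because its
    exponent s dominates k. *)
Lemma orlicz_moment_sparse (p k : nat) (alpha c : R) (x : T -> 'cV[R]_p)
    (theta : 'cV[R]_p) : (0 < k)%N -> 0 < alpha -> 0 < c ->
  (forall j, measurable_fun setT (fun w => x w j 0)) ->
  (forall j, orlicz_moment_le alpha c 2 (fun w => x w j 0)) ->
  Theta p k theta ->
  orlicz_moment_le alpha (c * Num.sqrt k%:R) (2 * k%:R)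
    (fun w => dotv (x w) theta).
Proof.
move=> k0 alpha0 c0 mx hx Ht.
have kR : 1 <= k%:R :> R by rewrite ler1n.
have sk0 : 0 < Num.sqrt k%:R :> R by rewrite sqrtr_gt0 ltr0n.
set S := [set j | theta j 0 != 0]%SET.
have Sk : (#|S| <= k)%N by rewrite card_supp; case: Ht.
have mM j := measurable_orlicz alpha c (mx j).
have iM j := Rintegrable_of_le (mM j) (fun w => expR_ge0 _) (hx j).
have mdot : measurable_fun setT (fun w => dotv (x w) theta).
  under eq_fun do rewrite dotvE.
  by apply: measurable_fun_bigsum => j; apply: measurable_funM => //; exact: measurable_cst.
have [S0|[j0 j0S]] := set_0Vmem S.
  have t0 : theta = 0.
    apply/colP => j; rewrite mxE; apply/eqP; rewrite -[_ == _]negbK.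
    by have := finset.in_set0 j; rewrite -S0 inE => ->.
  rewrite /orlicz_moment_le.
  have e1 w : expR ((`|dotv (x w) theta| / (c * Num.sqrt k%:R)) `^ alpha) = 1.
    by rewrite t0 /dotv mulmx0 mxE normr0 mul0r powR0 ?expR0// gt_eqF.
  rewrite (eq_integral (fun=> (1 : R)%:E)) => [|w _]; last by rewrite e1.
  rewrite Rintegral_EFin; last exact: prob_integrable_cst.
  by rewrite prob_Rintegral_cst lee_fin; lra.
apply: (@le_trans _ _ (\int[P]_w
    (\sum_(j <- enum S) expR ((`|x w j 0| / c) `^ alpha))%:E)%E); last first.
  rewrite Rintegral_EFin; last by apply: Rintegrable_sum => j; have [] := iM j.
  rewrite Rintegral_sum; last by move=> j; have [] := iM j.
  rewrite lee_fin; apply: (@le_trans _ _ (\sum_(j <- enum S) 2)).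
    by apply: ler_sum => j _; have [] := iM j.
  by rewrite big_const_seq count_predT iter_addr_0 -cardE -[leLHS]mulr_natr ler_pM2l// ler_nat.
apply: integral_EFin_le.
- exact: measurable_orlicz.
- exact: measurable_fun_bigsum.
- by move=> w; exact: expR_ge0.
move=> w; have [jm jmS jmax] := arg_maxP (fun j => `|x w j 0|) j0S.
have hdot : `|dotv (x w) theta| <= `|x w jm 0| * Num.sqrt k%:R.
  rewrite dotvE (le_trans (ler_norm_sum _ _ _))//.
  apply: (@le_trans _ _ (\sum_j `|x w jm 0| * `|theta j 0|)).
    apply: ler_sum => j _; rewrite normrM.
    have [->|tj] := eqVneq (theta j 0) 0; first by rewrite normr0 !mulr0.
    have jS : j \in S by rewrite inE.
    by rewrite ler_wpM2r//; exact: (jmax j jS).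
  rewrite -mulr_sumr ler_wpM2l//.
  apply: (le_trans (sparse_l1_le (@supported_supp _ _ theta))).
  rewrite -[leRHS]mulr1 ler_pM ?sqrtr_ge0 ?l2norm_ge0//; last by case: Ht.
  by rewrite ler_wsqrtr// ler_nat.
rewrite (bigD1_seq jm) ?mem_enum ?enum_uniq//= -[leLHS]addr0 lerD//; last first.
  by apply: sumr_ge0 => j _; exact: expR_ge0.
rewrite ler_expR ge0_ler_powR ?nnegrE ?(ltW alpha0) ?divr_ge0 ?(ltW c0)//.
  by rewrite mulr_ge0 ?(ltW c0) ?(ltW sk0).
rewrite ler_pdivrMr ?mulr_gt0//.
have -> : `|x w jm 0| / c * (c * Num.sqrt k%:R) = `|x w jm 0| * Num.sqrt k%:R.
  by field; rewrite gt_eqF.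
exact: hdot.
Qed.

End orlicz_moments.

(** * Averages and the cost of the union bound *)

Section deviation_of_averages.
Context {R : realType}.

Definition threshold (beta : R) (n : nat) (v L s : R) : R :=
  n%:R^-1 * (2 * Num.sqrt (n%:R * v * s)
    + conc_const beta * (L * (ln (2 * n%:R) `^ (1 / beta) * s `^ (1 / T1 beta)))).

Definition dev_const (beta : R) : R :=
  2 * conc_const beta * 12 `^ (1 / T1 beta).

Lemma conc_const_ge0 (beta : R) : 0 <= conc_const beta.
Proof. by rewrite mulr_ge0 ?powR_ge0// !addr_ge0 ?powR_ge0. Qed.

Lemma dev_const_ge0 (beta : R) : 0 <= dev_const beta.
Proof.
apply: mulr_ge0; last exact: powR_ge0.
by apply: mulr_ge0 => //; exact: conc_const_ge0.
Qed.

Lemma average_deviation d (T : measurableType d) (P : probability T R)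
    (n : nat) (V : 'I_n -> T -> R) (beta L D s v : R) :
  (forall i, measurable_fun setT (V i)) -> independent_family P V ->
  (0 < n)%N -> 0 < beta -> 0 < L ->
  (forall i, orlicz_moment_le P beta L D (V i)) -> 1 <= s -> D <= 2 * s ->
  ((n%:R^-1)%:E * \sum_(i < n) 'V_P[V i] <= v%:E)%E ->
  (P [set w | threshold beta n v L s
       < n%:R^-1 * \sum_(i < n) (V i w - fine ('E_P[V i])%E)]%R
     <= (2 * expR (- s))%:E)%E.
Proof.
move=> mV indV n0 beta0 L0 orl s1 Ds hv.
have nR : 0 < n%:R :> R by rewrite ltr0n.
have hv' : (\sum_(i < n) 'V_P[V i] <= (n%:R * v)%:E)%E.
  by rewrite EFinM -lee_pdivrMl.
have := concentration mV indV n0 beta0 L0 orl s1 Ds hv'.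
congr (P _ <= _)%E; apply/seteqP; split => w /=;
  by rewrite /threshold ltr_pM2l ?invr_gt0//.
Qed.

(** The factor 2 is the loss incurred on the net, and 12 u the exponent that pays
    for the union bound: in the Gaussian term they give 4 sqrt 12 <= 14, in the
    other one they are part of the constant. *)
Lemma two_threshold_le (beta : R) (n : nat) (v L u : R) :
  (0 < n)%N -> 0 <= v -> 0 <= u ->
  2 * threshold beta n v L (12 * u) <= 14 * Num.sqrt (v * u / n%:R)
    + dev_const beta * (L * (ln (2 * n%:R) `^ (1 / beta) * u `^ (1 / T1 beta) / n%:R)).
Proof.
move=> n0 v0 u0; have nR : 0 < n%:R :> R by rewrite ltr0n.
rewrite /threshold /dev_const powRM//.
set x := v * u / n%:R.
have x0 : 0 <= x by rewrite divr_ge0 ?mulr_ge0// ltW.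
have -> : n%:R * v * (12 * u) = 12 * n%:R ^+ 2 * x.
  by rewrite /x; field; rewrite gt_eqF.
rewrite sqrtrM ?mulr_ge0 ?sqr_ge0// sqrtrM// sqrtr_sqr gtr0_norm//.
have s12 : Num.sqrt 12 <= 7 / 2 :> R.
  rewrite -(@ler_pXn2r _ 2)// ?nnegrE ?sqrtr_ge0//.
  by rewrite sqr_sqrtr//; lra.
have := ler_wpM2r (sqrtr_ge0 x) s12.
set a := Num.sqrt 12; set y := Num.sqrt x.
set l := ln _ `^ _; set c12 := 12 `^ _; set w := u `^ _; set c := conc_const beta.
have -> : 2 * (n%:R^-1 * (2 * (a * n%:R * y) + c * (L * (l * (c12 * w))))) =
    4 * (a * y) + 2 * c * c12 * (L * (l * w / n%:R)) by field; rewrite gt_eqF.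
by move=> h; rewrite lerD2r; lra.
Qed.

Lemma ereal_sup_bounded (S : set (\bar R)) (x0 : \bar R) (q : R) : S x0 ->
  (forall x, S x -> 0 <= x /\ x <= q%:E)%E ->
  0 <= fine (ereal_sup S) /\ (forall x, S x -> x <= (fine (ereal_sup S))%:E)%E.
Proof.
move=> Sx0 hS.
have le0 : (0 <= ereal_sup S)%E.
  by apply: le_trans (hS _ Sx0).1 _; exact: ereal_sup_ubound.
have leq : (ereal_sup S <= q%:E)%E by apply: ge_ereal_sup => x /hS[].
split; first exact: fine_ge0.
move=> x Sx; rewrite fineK; first exact: ereal_sup_ubound.
by rewrite ge0_fin_numE// (le_lt_trans leq)// ltry.
Qed.

(** u already contains k log (p / k), so 12 u - t exceeds the logarithm of the
    number of net points. *)
Lemma net_union_factor (p k q c : nat) (t : R) :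
  (0 < k)%N -> (k <= p)%N -> (q <= 4)%N -> (3 <= c)%N -> 0 <= t ->
  let u := t + k%:R * ln (c%:R * expR 1 * p%:R / k%:R) in
  k%:R <= u /\ #|@net R p k q|%:R * expR (- (12 * u)) <= expR (- t).
Proof.
move=> k0 kp q4 c3 t0 u.
have kR : 0 < k%:R :> R by rewrite ltr0n.
have pR : 0 < p%:R :> R by rewrite ltr0n (leq_trans k0).
have cR : 3 <= c%:R :> R by rewrite ler_nat.
have c0 : 0 < c%:R :> R by lra.
have kpR : 1 <= p%:R / k%:R :> R by rewrite ler_pdivlMr// mul1r ler_nat.
pose z : R := ln (c%:R * (p%:R / k%:R)).
have cz : 3 <= c%:R * (p%:R / k%:R) :> R.
  by rewrite -[leLHS]mulr1 ler_pM.
have z0 : 0 <= z by apply: ln_ge0; lra.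
have uE : u = t + k%:R * (1 + z).
  rewrite /u; congr (_ + _ * _).
  have -> : c%:R * expR 1 * p%:R / k%:R = expR 1 * (c%:R * (p%:R / k%:R)) :> R by ring.
  by rewrite lnM ?posrE ?expR_gt0 ?expRK//; lra.
have kz : 0 <= k%:R * z by rewrite mulr_ge0// ltW.
split; first by rewrite uE; lra.
have hl : ln (2 * p%:R / k%:R) <= z.
  have a1 : 0 < 2 * p%:R / k%:R :> R by rewrite divr_gt0 ?mulr_gt0.
  have a2 : 0 < c%:R * (p%:R / k%:R) :> R by lra.
  rewrite ler_ln ?posrE// -mulrA; apply: ler_wpM2r; lra.
apply: le_trans (ler_wpM2r (expR_ge0 _) (card_net R q k0 kp)) _.
rewrite -expRD ler_expR uE natrM.
have qR : q%:R <= 4 :> R by rewrite ler_nat.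
have h1 : k%:R * ln (2 * p%:R / k%:R) <= k%:R * z by rewrite ler_pM2l.
have h2 : q%:R * (k%:R * ln (2 * p%:R / k%:R)) <= q%:R * (k%:R * z).
  by apply: ler_wpM2l.
have h3 : q%:R * (k%:R * z) <= 4 * (k%:R * z) by apply: ler_wpM2r.
rewrite -mulrA; lra.
Qed.

End deviation_of_averages.

(** * Uniform deviation over sparse vectors *)

Section uniform_deviation.
Context {R : realType} {d : measure_display} {T : measurableType d}.
Variables (P : probability T R) (n p k : nat) (t alpha : R).
Variables (X : 'I_n -> {RV P >-> p.-tuple R}) (Y : 'I_n -> {RV P >-> R}).
Hypotheses (n0 : (0 < n)%N) (k0 : (0 < k)%N) (kp : (k <= p)%N) (t0 : 0 <= t).
Hypothesis alpha0 : 0 < alpha.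
Hypothesis indep : independent_family P (fun i w => (X i w, Y i w)).

Let beta := alpha / 2.
Let beta0 : 0 < beta. Proof. by rewrite divr_gt0. Qed.
Let kR : 1 <= k%:R :> R. Proof. by rewrite ler1n. Qed.

Let VG theta i w := dotv theta (vec X i w) * Y i w.
Let VS theta i w := dotv theta (vec X i w) ^+ 2.

Let mdot theta i : measurable_fun setT (fun w => dotv theta (vec X i w)).
Proof.
under eq_fun do rewrite dotvE.
apply: measurable_fun_bigsum => j; apply: measurable_funM; first exact: measurable_cst.
exact: measurable_coord.
Qed.

Let mVG theta i : measurable_fun setT (VG theta i).
Proof. by apply: measurable_funM; [exact: mdot|exact: measurable_response]. Qed.

Let mVS theta i : measurable_fun setT (VS theta i).
Proof. exact/measurable_funX/mdot. Qed.

Let mtupledot (theta : 'cV[R]_p) :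
  measurable_fun setT (fun z : p.-tuple R * R => \sum_j theta j 0 * tnth z.1 j).
Proof.
apply: measurable_fun_bigsum => j; apply: measurable_funM; first exact: measurable_cst.
exact: (measurableT_comp (measurable_tnth j) measurable_fst).
Qed.

Let indVG theta : independent_family P (VG theta).
Proof.
pose g (i : 'I_n) (z : p.-tuple R * R) := (\sum_j theta j 0 * tnth z.1 j) * z.2.
have mg i : measurable_fun setT (g i).
  by apply: measurable_funM; [exact: mtupledot|exact: measurable_snd].
have := independent_family_comp mg indep.
congr (independent_family P _); apply/funext => i; apply/funext => w /=.
by rewrite /VG /g dotvE/=; congr (_ * _); apply: eq_bigr => j _; rewrite mxE.
Qed.

Let indVS theta : independent_family P (VS theta).
Proof.
pose g (i : 'I_n) (z : p.-tuple R * R) := (\sum_j theta j 0 * tnth z.1 j) ^+ 2.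
have mg i : measurable_fun setT (g i) by exact: measurable_funX (mtupledot theta).
have := independent_family_comp mg indep.
congr (independent_family P _); apply/funext => i; apply/funext => w /=.
by rewrite /VS /g dotvE/=; congr (_ ^+ _); apply: eq_bigr => j _; rewrite mxE.
Qed.

Let indVSN theta : independent_family P (fun i w => - VS theta i w).
Proof.
have mN (i : 'I_n) : measurable_fun setT (fun x : R => - x).
  by apply: measurable_funN; exact: measurable_id.
exact: independent_family_comp mN (indVS theta).
Qed.

Variables (c0 LG LS : R).
Hypotheses (c00 : 0 < c0) (LG0 : 0 < LG) (LS0 : 0 < LS).
Hypothesis coordX : forall i j, orlicz_moment_le P alpha c0 2 (fun w => vec X i w j 0).
Hypothesis coordY : forall i, orlicz_moment_le P alpha c0 2 (Y i).
Hypothesis orlG : forall theta i, Theta p k theta ->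
  orlicz_moment_le P beta LG (2 * k%:R) (VG theta i).
Hypothesis orlS : forall theta i, Theta p k theta ->
  orlicz_moment_le P beta LS (2 * k%:R) (VS theta i).

Let cc0 : 0 < c0 * c0. Proof. exact: mulr_gt0. Qed.

Let intXY i a : P.-integrable setT (EFin \o (fun w => vec X i w a 0 * Y i w)).
Proof.
have mX := @measurable_coord _ _ _ _ _ _ X i a.
have mY := @measurable_response _ _ _ _ _ Y i.
apply: (orlicz_integrable beta0 cc0); first exact: measurable_funM.
exact: (orlicz_moment_mul c00 c00 mX mY (coordX i a) (coordY i)).
Qed.

Let intXX i a b :
  P.-integrable setT (EFin \o (fun w => vec X i w a 0 * vec X i w b 0)).
Proof.
have mX j := @measurable_coord _ _ _ _ _ _ X i j.
apply: (orlicz_integrable beta0 cc0); first exact: measurable_funM.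
exact: (orlicz_moment_mul c00 c00 (mX a) (mX b) (coordX i a) (coordX i b)).
Qed.

(** The Orlicz moments bound all the variances by one constant Q, so the supremum
    is finite and taking its real value loses nothing. *)
Let average_variance_le (V : 'cV[R]_p -> 'I_n -> T -> R) (L : R) : 0 < L ->
  (forall theta i, measurable_fun setT (V theta i)) ->
  (forall theta i, Theta p k theta ->
     orlicz_moment_le P beta L (2 * k%:R) (V theta i)) ->
  let U := ereal_sup [set ((n%:R^-1)%:E * \sum_(i < n) 'V_P[V theta i])%E
    | theta in Theta p k] in
  0 <= fine U /\ (forall theta, Theta p k theta ->
    ((n%:R^-1)%:E * \sum_(i < n) 'V_P[V theta i] <= (fine U)%:E)%E).
Proof.
move=> L0 mV orl U.
have nR : 0 < n%:R :> R by rewrite ltr0n.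
pose z : 'cV[R]_p := 0.
have q theta i (Ht : Theta p k theta) :=
  orlicz_variance_le beta0 L0 (mV theta i) (orl theta i Ht).
move: q; set Q := (X in X%:E) => q.
have [|x [theta Ht <-]|U0 hU] := @ereal_sup_bounded R
  [set ((n%:R^-1)%:E * \sum_(i < n) 'V_P[V theta i])%E | theta in Theta p k]
  ((n%:R^-1)%:E * \sum_(i < n) 'V_P[V z i])%E Q.
- by exists z => //; exact: Theta0.
- have s0 : (0 <= \sum_(i < n) 'V_P[V theta i])%E.
    by apply: sume_ge0 => i _; exact: variance_ge0.
  split; first by apply: mule_ge0 => //; rewrite lee_fin invr_ge0 ltW.
  rewrite lee_pdivrMl// -EFinM mulr_natl.
  have -> : Q *+ n = \sum_(i < n) Q by rewrite sumr_const card_ord.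
  by rewrite -sumEFin; apply: lee_sum => i _; exact: q.
by split => // theta Ht; apply: hU; exists theta.
Qed.

Let u3 := t + k%:R * ln (3 * expR 1 * p%:R / k%:R).
Let u5 := t + k%:R * ln (5 * expR 1 * p%:R / k%:R).

Let UG := fine (Upsilon_Gamma X Y k).
Let US := fine (Upsilon_Sigma X k).

Let hUG : 0 <= UG /\ (forall theta, Theta p k theta ->
    ((n%:R^-1)%:E * \sum_(i < n) 'V_P[VG theta i] <= UG%:E)%E).
Proof. exact: average_variance_le LG0 mVG orlG. Qed.

Let hUS : 0 <= US /\ (forall theta, Theta p k theta ->
    ((n%:R^-1)%:E * \sum_(i < n) 'V_P[VS theta i] <= US%:E)%E).
Proof. exact: average_variance_le LS0 mVS orlS. Qed.

Let net_Theta q f : f \in @net R p k q -> Theta p k (grid_point f : 'cV[R]_p).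
Proof. by rewrite inE => /andP[_ /asboolP]. Qed.

Let u_ge (u : R) : k%:R <= u -> [/\ 0 <= u, 1 <= 12 * u & 2 * k%:R <= 2 * (12 * u)].
Proof. by move=> ku; have := kR; split; lra. Qed.

Let thG := threshold beta n UG LG (12 * u3).
Let thS := threshold beta n US LS (12 * u5).

Let expectationN (V : T -> R) : P.-integrable setT (EFin \o V) ->
  fine ('E_P[fun w => (- V w)%R])%E = - fine ('E_P[V])%E.
Proof.
move=> iV; rewrite !fine_expectation.
under eq_Rintegral do rewrite -mulN1r.
by rewrite RintegralZl// mulN1r.
Qed.

Let varianceN_integrable (V : T -> R) : P.-integrable setT (EFin \o V) ->
  ('V_P[fun w => (- V w)%R] = 'V_P[V])%E.
Proof.
move=> iV; rewrite !variance_integral expectationN//.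
by apply: eq_integral => w _; congr (_%:E); ring.
Qed.

Let bad_Gamma : exists B : set T, [/\ measurable B,
  (P B <= (2 * expR (- t))%:E)%E &
  forall w, ~ B w -> DD X Y k w <= 2 * thG].
Proof.
have [ku hcard] := net_union_factor k0 kp (isT : (2 <= 4)%N) (isT : (3 <= 3)%N) t0.
rewrite -/u3 in ku hcard.
have [u0 s1 Ds] := u_ge ku.
pose E (f : grid_code p k 2) : set T := [set w | thG
  < n%:R^-1 * \sum_(i < n) (VG (grid_point f) i w
      - fine ('E_P[VG (grid_point f) i])%E)].
have mE f : measurable (E f).
  apply: measurable_strict_superlevel; apply: measurable_funM; first exact: measurable_cst.
  apply: measurable_fun_bigsum => i.
  by apply: measurable_funB; [exact: mVG|exact: measurable_cst].
have [|B [mB PB hB]] := @union_bound R d T P _ (enum (@net R p k 2)) E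
    (2 * expR (- (12 * u3))) mE.
  move=> f; rewrite mem_enum => /net_Theta Ht.
  apply: (average_deviation _ _ n0 beta0 LG0 _ s1 Ds (hUG.2 _ Ht)) => //.
  by move=> i; exact: orlG.
exists B; split => //.
  apply: (le_trans PB); rewrite lee_fin -cardE mulrCA.
  by rewrite ler_pM2l.
move=> w nB; apply: DD_le => // f fnet.
rewrite dotv_Gamma_dev// leNgt; apply/negP => hf.
by apply: nB; apply: (hB f) => //; rewrite mem_enum.
Qed.

Let bad_Sigma : exists B : set T, [/\ measurable B,
  (P B <= (4 * expR (- t))%:E)%E &
  forall w, ~ B w -> RIP X k w <= 2 * thS].
Proof.
have [ku hcard] := net_union_factor k0 kp (isT : (4 <= 4)%N) (isT : (3 <= 5)%N) t0.
rewrite -/u5 in ku hcard.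
have [u0 s1 Ds] := u_ge ku.
pose dev (f : grid_code p k 4) w := n%:R^-1 * \sum_(i < n)
  (VS (grid_point f) i w - fine ('E_P[VS (grid_point f) i])%E).
have mdev f : measurable_fun setT (dev f).
  apply: measurable_funM; first exact: measurable_cst.
  apply: measurable_fun_bigsum => i.
  by apply: measurable_funB; [exact: mVS|exact: measurable_cst].
pose E (f : grid_code p k 4) : set T :=
  [set w | thS < dev f w] `|` [set w | thS < - dev f w].
have mE1 f : measurable [set w | thS < dev f w] by exact: measurable_strict_superlevel.
have mE2 f : measurable [set w | thS < - dev f w].
  by apply: measurable_strict_superlevel; exact: measurable_funN.
have mE f : measurable (E f) by exact: measurableU.
have [|B [mB PB hB]] := @union_bound R d T P _ (enum (@net R p k 4)) E
    (4 * expR (- (12 * u5))) mE.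
  move=> f; rewrite mem_enum => /net_Theta Ht.
  have iV i : P.-integrable setT (EFin \o VS (grid_point f) i).
    exact: (orlicz_integrable beta0 LS0 (mVS _ _) (orlS i Ht)).
  apply: (le_trans (measureU2 P (mE1 f) (mE2 f))).
  have -> : 4 * expR (- (12 * u5)) = 2 * expR (- (12 * u5)) + 2 * expR (- (12 * u5)).
    by ring.
  rewrite EFinD; apply: leeD.
    apply: (average_deviation _ _ n0 beta0 LS0 _ s1 Ds (hUS.2 _ Ht)) => //.
    by move=> i; exact: orlS.
  have devN w : - dev f w = n%:R^-1 * \sum_(i < n) ((fun w => - VS (grid_point f) i w) w
        - fine ('E_P[fun w => (- VS (grid_point f) i w)%R])%E).
    rewrite /dev -mulrN -sumrN; congr (_ * _); apply: eq_bigr => i _.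
    by rewrite expectationN//; ring.
  under eq_set do rewrite devN.
  apply: (average_deviation (V := fun i w => - VS (grid_point f) i w)
    _ _ n0 beta0 LS0 _ s1 Ds).
  - by move=> i; apply: measurable_funN.
  - exact: indVSN.
  - move=> i; rewrite /orlicz_moment_le.
    by under eq_integral do rewrite normrN; exact: orlS.
  - under eq_bigr do rewrite varianceN_integrable//.
    exact: hUS.2.
exists B; split => //.
  apply: (le_trans PB); rewrite lee_fin -cardE mulrCA.
  by rewrite ler_pM2l.
move=> w nB; apply: RIP_le => // f fnet.
have nE : ~ E f w by move=> Ew; apply: nB; apply: (hB f) => //; rewrite mem_enum.
rewrite dotv_Sigma_dev// -/(dev f w) ler_norml.
have /not_orP[h1 h2] := nE.
by move/negP: h1; move/negP: h2; rewrite /= -!leNgt; lra.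
Qed.

(** What the marginal and the joint hypotheses have in common: Orlicz moments of
    sparse combinations at scales LG and LS, which differ between the two. The
    failure probability is 2 exp (- t) for the vector and 4 exp (- t) for the
    matrix, whose deviations are two-sided. *)
Lemma uniform_deviation (BG BS : R) :
  14 * Num.sqrt (UG * u3 / n%:R) + dev_const beta
    * (LG * (ln (2 * n%:R) `^ (1 / beta) * u3 `^ (1 / T1 beta) / n%:R)) <= BG ->
  14 * Num.sqrt (US * u5 / n%:R) + dev_const beta
    * (LS * (ln (2 * n%:R) `^ (1 / beta) * u5 `^ (1 / T1 beta) / n%:R)) <= BS ->
  ((1 - 6 * expR (- t))%:E <= P [set w | DD X Y k w <= BG /\ RIP X k w <= BS]%R)%E.
Proof.
move=> hBG hBS.
have nR : 0 < n%:R :> R by rewrite ltr0n.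
have [k3 _] := net_union_factor k0 kp (isT : (2 <= 4)%N) (isT : (3 <= 3)%N) t0.
have [k5 _] := net_union_factor k0 kp (isT : (4 <= 4)%N) (isT : (3 <= 5)%N) t0.
rewrite -/u3 -/u5 in k3 k5.
have [u30 _ _] := u_ge k3; have [u50 _ _] := u_ge k5.
have tG := le_trans (two_threshold_le beta LG n0 hUG.1 u30) hBG.
have tS := le_trans (two_threshold_le beta LS n0 hUS.1 u50) hBS.
have pos (L u v : R) : 0 < L -> 0 <= 14 * Num.sqrt v + dev_const beta
    * (L * (ln (2 * n%:R) `^ (1 / beta) * u `^ (1 / T1 beta) / n%:R)).
  move=> L0; apply: addr_ge0; first by rewrite mulr_ge0// sqrtr_ge0.
  apply: mulr_ge0; first exact: dev_const_ge0.
  by rewrite !mulr_ge0 ?powR_ge0 ?invr_ge0 ?(ltW L0) ?(ltW nR).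
have BG0 : 0 <= BG by apply: le_trans hBG; exact: pos.
have BS0 : 0 <= BS by apply: le_trans hBS; exact: pos.
have [B1 [mB1 PB1 hB1]] := bad_Gamma; have [B2 [mB2 PB2 hB2]] := bad_Sigma.
set G := [set w | _].
have mG : measurable G.
  by apply: measurableI; [exact: measurable_DD_le|exact: measurable_RIP_le].
have sub : ~` (B1 `|` B2) `<=` G.
  move=> w /not_orP[nB1 nB2]; split.
    exact: le_trans (hB1 _ nB1) tG.
  exact: le_trans (hB2 _ nB2) tS.
have mB : measurable (B1 `|` B2) by exact: measurableU.
apply: (@le_trans _ _ (P (~` (B1 `|` B2)))); last first.
  by apply: le_measure; rewrite ?inE//; exact: measurableC.
have := probability_setC P mB => ->.
have PB : (P (B1 `|` B2) <= (6 * expR (- t))%:E)%E.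
  apply: (le_trans (measureU2 P mB1 mB2)).
  have -> : 6 * expR (- t) = 2 * expR (- t) + 4 * expR (- t) by ring.
  by rewrite EFinD leeD.
by rewrite EFinB leeB.
Qed.

End uniform_deviation.

(** * The marginal and the joint tail conditions *)

Lemma maxe_leP (R : realType) (a b c : \bar R) :
  (maxe a b <= c)%E -> (a <= c /\ b <= c)%E.
Proof. by rewrite ge_max => /andP[]. Qed.

Section marginal_and_joint.
Context {R : realType} {d : measure_display} {T : measurableType d}.
Variables (P : probability T R) (n p k : nat) (alpha K : R).
Variables (X : 'I_n -> {RV P >-> p.-tuple R}) (Y : 'I_n -> {RV P >-> R}).
Hypotheses (k0 : (0 < k)%N) (alpha0 : 0 < alpha) (K0 : 0 < K).

Let K2 : K < 2 * K. Proof. by have := K0; lra. Qed.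
Let K20 : 0 < 2 * K. Proof. exact: mulr_gt0. Qed.
Let kR : 1 <= k%:R :> R. Proof. by rewrite ler1n. Qed.

Let mX i j : measurable_fun setT (fun w => vec X i w j 0).
Proof. exact: measurable_coord. Qed.

Let mdot i theta : measurable_fun setT (fun w => dotv (vec X i w) theta).
Proof.
under eq_fun do rewrite dotvE.
apply: measurable_fun_bigsum => j; apply: measurable_funM; last exact: measurable_cst.
exact: mX.
Qed.

Lemma orlicz_moment_Gamma (c D : R) theta i : 0 < c -> D <= 2 * k%:R ->
  orlicz_moment_le P alpha c D (fun w => dotv (vec X i w) theta) ->
  orlicz_moment_le P alpha (2 * K) 2 (Y i) ->
  orlicz_moment_le P (alpha / 2) (c * (2 * K)) (2 * k%:R)
    (fun w => dotv theta (vec X i w) * Y i w).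
Proof.
move=> c0 Dk hX hY.
have -> : (fun w => dotv theta (vec X i w) * Y i w) =
    (fun w => dotv (vec X i w) theta * Y i w).
  by apply/funext => w; rewrite dotvC.
apply: orlicz_momentW (orlicz_moment_mul c0 K20 (mdot i theta) _ hX hY).
  by have := kR; lra.
exact: measurable_response.
Qed.

Lemma orlicz_moment_Sigma (c D : R) theta i : 0 < c -> D <= 2 * k%:R ->
  orlicz_moment_le P alpha c D (fun w => dotv (vec X i w) theta) ->
  orlicz_moment_le P (alpha / 2) (c * c) (2 * k%:R)
    (fun w => dotv theta (vec X i w) ^+ 2).
Proof.
move=> c0 Dk hX.
have -> : (fun w => dotv theta (vec X i w) ^+ 2) =
    (fun w => dotv (vec X i w) theta * dotv (vec X i w) theta).
  by apply/funext => w; rewrite dotvC expr2.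
apply: orlicz_momentW (orlicz_moment_mul c0 c0 (mdot i theta) (mdot i theta) hX hX).
lra.
Qed.

Lemma MExp_moments : (0 < p)%N -> MExp X Y alpha K ->
  (forall i j, orlicz_moment_le P alpha (2 * K) 2 (fun w => vec X i w j 0)) /\
  (forall i, orlicz_moment_le P alpha (2 * K) 2 (Y i)).
Proof.
move=> p0 hM.
have h i j : (psi_norm P alpha (fun w => (vec X i w j 0)%R) <= K%:E)%E /\
    (psi_norm P alpha (Y i) <= K%:E)%E.
  apply: maxe_leP; apply: le_trans (hM i).
  exact: (le_bigmax -oo%E (fun j => maxe (psi_norm P alpha (fun w => vec X i w j 0))
    (psi_norm P alpha (Y i))) j).
split=> [i j|i]; apply: (psi_norm_moment alpha0 K2).
- exact: mX.
- exact: (h i j).1.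
- exact: measurable_response.
- exact: (h i (Ordinal p0)).2.
Qed.

Lemma JExp_moments : JExp X Y alpha K ->
  [/\ (forall i theta, l2norm theta <= 1 ->
         orlicz_moment_le P alpha (2 * K) 2 (fun w => dotv (vec X i w) theta)),
      (forall i j, orlicz_moment_le P alpha (2 * K) 2 (fun w => vec X i w j 0)) &
      (forall i, orlicz_moment_le P alpha (2 * K) 2 (Y i))].
Proof.
move=> hJ.
have hd i theta : l2norm theta <= 1 ->
    orlicz_moment_le P alpha (2 * K) 2 (fun w => dotv (vec X i w) theta).
  move=> t1; apply: (psi_norm_moment alpha0 K2); first exact: mdot.
  by have /maxe_leP[] := hJ i theta t1.
split => // [i j|i].
  have e1 : l2norm (delta_mx j 0 : 'cV[R]_p) <= 1.
    rewrite /l2norm (bigD1 j)//= big1 => [|l lj].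
      by rewrite mxE !eqxx expr1n addr0 sqrtr1.
    by rewrite mxE (negbTE lj) expr0n.
  have := hd i _ e1; congr orlicz_moment_le; apply/funext => w.
  rewrite dotvE (bigD1 j)//= big1 => [|l lj].
    by rewrite [X in _ * X]mxE !eqxx mulr1 addr0.
  by rewrite [X in _ * X]mxE (negbTE lj) mulr0.
apply: (psi_norm_moment alpha0 K2); first exact: measurable_response.
have : l2norm (0 : 'cV[R]_p) <= 1 by rewrite l2norm0.
by move=> /(hJ i) /maxe_leP[].
Qed.

End marginal_and_joint.

Theorem theorem11 (R : realType) (alpha : R) (halpha : 0 < alpha) :
  exists C : R,
  forall (d : measure_display) (T : measurableType d) (P : probability T R)
    (n p k : nat) (t K : R)
    (X : 'I_n -> {RV P >-> p.-tuple R}) (Y : 'I_n -> {RV P >-> R}),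
  (1 <= n)%N -> (1 <= k <= p)%N -> 0 <= t -> 0 < K ->
  independent_family P (fun i w => (X i w, Y i w)) ->
  let u3 := t + k%:R * ln (3 * expR 1 * p%:R / k%:R) in
  let u5 := t + k%:R * ln (5 * expR 1 * p%:R / k%:R) in
  (MExp X Y alpha K ->
    ((1 - 6 * expR (- t))%:E <=
     P [set w | (
        DD X Y k w <=
          14 * Num.sqrt (fine (Upsilon_Gamma X Y k) * u3 / n%:R)
          + C * K ^+ 2 * (Num.sqrt k%:R * ln (2 * n%:R) `^ (2 / alpha)
                          * u3 `^ (1 / T1 (alpha / 2)) / n%:R)
        /\
        RIP X k w <=
          14 * Num.sqrt (fine (Upsilon_Sigma X k) * u5 / n%:R)
          + C * K ^+ 2 * (k%:R * ln (2 * n%:R) `^ (2 / alpha)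
                          * u5 `^ (1 / T1 (alpha / 2)) / n%:R))%R])%E)
  /\
  (JExp X Y alpha K ->
    ((1 - 6 * expR (- t))%:E <=
     P [set w | (
        DD X Y k w <=
          14 * Num.sqrt (fine (Upsilon_Gamma X Y k) * u3 / n%:R)
          + C * K ^+ 2 * (ln (2 * n%:R) `^ (2 / alpha)
                          * u3 `^ (1 / T1 (alpha / 2)) / n%:R)
        /\
        RIP X k w <=
          14 * Num.sqrt (fine (Upsilon_Sigma X k) * u5 / n%:R)
          + C * K ^+ 2 * (ln (2 * n%:R) `^ (2 / alpha)
                          * u5 `^ (1 / T1 (alpha / 2)) / n%:R))%R])%E).
Proof.
(* The scale 2 K, strictly above the bound K on the norms, enters squared. *)
exists (4 * dev_const (alpha / 2)) => d T P n p k t K X Y n1 /andP[k1 kp] t0 K0.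
move=> indep u3 u5.
have p1 : (0 < p)%N by exact: leq_trans kp.
have k2 : 0 < 2 * K by exact: mulr_gt0.
have kR : 0 < k%:R :> R by rewrite ltr0n.
have kk : 2 <= 2 * k%:R :> R by rewrite ler_peMr// ler1n.
have sk0 : 0 < Num.sqrt k%:R :> R by rewrite sqrtr_gt0.
have sk : Num.sqrt k%:R * Num.sqrt k%:R = k%:R :> R.
  by rewrite -expr2 sqr_sqrtr// ltW.
have e2 : 2 / alpha = 1 / (alpha / 2) by field; rewrite gt_eqF.
rewrite e2; split.
- move=> /(MExp_moments halpha K0 p1)[hX hY].
  pose c := 2 * K * Num.sqrt k%:R.
  have c0 : 0 < c by exact: mulr_gt0.
  have cc : c * c = 4 * K ^+ 2 * k%:R.
    have -> : c * c = 4 * K ^+ 2 * (Num.sqrt k%:R * Num.sqrt k%:R) by rewrite /c; ring.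
    by rewrite sk.
  have hd theta i : Theta p k theta ->
      orlicz_moment_le P alpha c (2 * k%:R) (fun w => dotv (vec X i w) theta).
    apply: orlicz_moment_sparse => // j; exact: measurable_coord.
  apply: (uniform_deviation n1 k1 kp t0 halpha indep k2 _ _ hX hY
      (LG := c * (2 * K)) (LS := c * c)).
  + exact: mulr_gt0.
  + exact: mulr_gt0.
  + by move=> theta i Ht; apply: (orlicz_moment_Gamma k1 K0 c0 (lexx _)) => //; exact: hd.
  + by move=> theta i Ht; apply: (orlicz_moment_Sigma c0 (lexx _)); exact: hd.
  + rewrite lerD2l le_eqVlt; apply/orP; left; apply/eqP; rewrite /u3 /c; ring.
  + rewrite lerD2l le_eqVlt; apply/orP; left; apply/eqP; rewrite /u5 cc; ring.
- move=> /(JExp_moments halpha K0)[hd hX hY].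
  apply: (uniform_deviation n1 k1 kp t0 halpha indep k2 _ _ hX hY
      (LG := 2 * K * (2 * K)) (LS := 2 * K * (2 * K))).
  + exact: mulr_gt0.
  + exact: mulr_gt0.
  + move=> theta i [_ t1]; apply: (orlicz_moment_Gamma k1 K0 k2 kk) => //; exact: hd.
  + move=> theta i [_ t1]; apply: (orlicz_moment_Sigma k2 kk); exact: hd.
  + rewrite lerD2l le_eqVlt; apply/orP; left; apply/eqP; rewrite /u3; ring.
  + rewrite lerD2l le_eqVlt; apply/orP; left; apply/eqP; rewrite /u5; ring.
Qed.
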